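(* Let $(X,d)$ be a complete metric space, let $\phi:X\to[0,\infty]$ be lower semicontinuous, and let $T>0$. Let $\tau_*>0$ be such that for all $v\in X$ and all $0<\tau\le\tau_*$ the mapping $u\mapsto d^2(u,v)/(2\tau)+\phi(u)$ is $(1/\tau)$-geodesically convex. Assume that $\phi$ has compact sublevels, that $u\mapsto|\partial\phi|(u)\in[0,\infty]$ is lower semicontinuous, and that the chain-rule inequality $$|(\phi\circ u)'|\le|\partial\phi|(u)\,|u'|\quad\text{a.e. in }(0,T)$$ holds for all $u\in AC^2(0,T;X)$ such that $|\partial\phi|(u)|u'|\in L^1(0,T)$. Let $u_{i-1}\in D(|\partial\phi|)$ be given with $|\partial\phi|(u_{i-1})\ne0$. Then, for all $0<\tau_i\le\tau_*$, there exists $u_i\in D(|\partial\phi|)$ with $u_i\ne u_{i-1}$ and $$\widehat G_i(u_i,u_{i-1})\le0.$$ Moreover, let $\{0=t_0^n<t_1^n<\dots<t_{N^n}^n=T\}$, $n\in\mathbb{N}$, be a sequence of partitions with $\tau_i^n=t_i^n-t_{i-1}^n$ and $\tau^n=\max_i\tau_i^n\to0$. Let $u_i^n\in D(|\partial\phi|)$ be such that $u_0^n=u_0$ and $$\sum_{i=1}^{N^n}\widehat G_i^n(u_i^n,u_{i-1}^n)^+\to0\quad\text{as }n\to\infty.$$ Then, for a subsequence (not relabeled), $\overline u^n(t)\to u(t)$ for all $t\in[0,T]$, where $u\in AC^2(0,T;X)$ is a curve of maximal slope for the functional $\phi$.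
   Context: $D(\phi)=\{v\in X:\phi(v)<\infty\}$. The local slope at $u\in D(\phi)$ is $|\partial\phi|(u)=\limsup_{v\to u}\frac{(\phi(u)-\phi(v))^+}{d(u,v)}$, and $D(|\partial\phi|)=\{v\in D(\phi):|\partial\phi|(v)<\infty\}$; $a^+=\max\{a,0\}$. Compact sublevels means that the sets $\{\phi\le c\}$, $c\in\mathbb{R}$, are compact. $AC^2(0,T;X)$ is the set of $u:[0,T]\to X$ for which there is $m\in L^2(0,T)$ with $d(u(s),u(t))\le\int_s^tm(r)\,\mathrm{d}r$ for all $0\le s<t\le T$. The metric derivative is $|u'|(t)=\lim_{s\to t}\frac{d(u(s),u(t))}{|s-t|}$, which exists for a.e. $t$ when $u\in AC^2(0,T;X)$. A locally absolutely continuous curve $u:[0,T]\to X$ is a curve of maximal slope for $\phi$ (with initial datum $u_0$) if $\phi\circ u$ is nonincreasing, $u(0)=u_0$, and $$\phi(u(t))+\frac12\int_0^t|u'|^2(s)\,\mathrm{d}s+\frac12\int_0^t|\partial\phi|^2(u(s))\,\mathrm{d}s=\phi(u_0)\quad\text{for all }t\in[0,T].$$ A continuous curve $\gamma:[0,1]\to X$ is a constant-speed geodesic if $d(\gamma(t),\gamma(s))=d(\gamma(0),\gamma(1))|t-s|$ for all $s,t\in[0,1]$. For $\lambda\in\mathbb{R}$, a functional $\eta:X\to(-\infty,\infty]$ is $\lambda$-geodesically convex if for all $x_0,x_1\in X$ with $\eta(x_0),\eta(x_1)<\infty$ there exists a constant-speed geodesic $\gamma$ connecting $x_0$ and $x_1$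 such that $\eta(\gamma(t))\le(1-t)\eta(x_0)+t\eta(x_1)-\frac{\lambda}{2}t(1-t)d^2(x_0,x_1)$ for all $t\in[0,1]$. For $u,v\in D(|\partial\phi|)$, $$\widehat G_i(u,v)=\phi(u)+\frac{1}{2\tau_i}d^2(u,v)+\frac{\tau_i}{2}|\partial\phi|^2(u)-\phi(v),$$ and $\widehat G_i^n$ is the same expression with $\tau_i$ replaced by $\tau_i^n$. The backward piecewise constant interpolant $\overline u^n:[0,T]\to X$ is given by $\overline u^n(0)=u_0^n$ and $\overline u^n(t)=u_j^n$ for $t\in(t_{j-1}^n,t_j^n]$. *)

(* Defs.v *)
From HB Require Import structures.
From mathcomp Require Import all_boot all_order all_algebra.
From mathcomp Require Import all_classical all_reals all_analysis.

Set Implicit Arguments.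
Unset Strict Implicit.
Unset Printing Implicit Defensive.
Import Order.TTheory GRing.Theory Num.Theory.
Import numFieldTopology.Exports numFieldNormedType.Exports.
Local Open Scope classical_set_scope.
Local Open Scope ring_scope.

#[short(type="completeMetricType")]
HB.structure Definition CompleteMetric (K : numDomainType) :=
  { M of Metric K M & Complete M }.

Section functionals.
Context {R : realType} {X : metricType R}.
Implicit Types (phi eta : X -> \bar R) (u v : X).
Local Open Scope ereal_scope.

Definition edom phi : set X := [set v | phi v < +oo].

(* The usual conventions: the slope is +oo outside [edom phi] and 0 at isolated
   points of X. The latter is the role of [maxe 0], as the library's upper
   limit along the improper filter [u^'] of an isolated point is -oo. *)
Definition local_slope phi u : \bar R :=
  if phi u < +oo then
    maxe 0 (limf_esup
      (fun v => maxe (phi u - phi v) 0 * ((mdist u v)^-1)%:E) u^')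
  else +oo.

Definition dom_slope phi : set X :=
  [set v | edom phi v /\ local_slope phi v < +oo].

(* Curves on [a, b] are represented by functions on all of R, whose values
   outside [a, b] are irrelevant. *)
Definition constant_speed_geodesic (gamma : R -> X) : Prop :=
  {within `[0%R, 1%R], continuous gamma} /\
  {in `[0%R, 1%R] &, forall s t,
    mdist (gamma t) (gamma s) = mdist (gamma 0) (gamma 1) * `|t - s|}%R.

Definition geodesically_convex (lambda : R) eta : Prop :=
  forall x0 x1 : X, eta x0 < +oo -> eta x1 < +oo ->
  exists gamma : R -> X, [/\ constant_speed_geodesic gamma,
    gamma 0%R = x0, gamma 1%R = x1 &
    forall t : R, t \in `[0%R, 1%R] ->
      eta (gamma t) <= (1 - t)%:E * eta x0 + t%:E * eta x1
        - (lambda / 2 * t * (1 - t) * mdist x0 x1 ^+ 2)%:E].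

Definition Ghat phi (tau : R) u v : \bar R :=
  phi u + (mdist u v ^+ 2 / (2 * tau))%:E
    + (tau / 2)%:E * local_slope phi u ^+ 2 - phi v.

End functionals.

Section curves.
Context {R : realType} {X : metricType R}.
Implicit Types (phi : X -> \bar R) (u : R -> X) (T : R).

Definition AC_curve (p : nat) T u : Prop :=
  exists m : R -> R,
    [/\ measurable_fun `]0, T[ m,
        lebesgue_measure.-integrable `]0, T[ (fun r => (`|m r| ^+ p)%:E) &
        forall s t, 0 <= s -> s < t -> t <= T ->
          ((mdist (u s) (u t))%:E
             <= \int[lebesgue_measure]_(r in `]s, t[) (m r)%:E)%E].

(* Only meaningful at the times where the limit exists, that is, at almost
   every time for an absolutely continuous curve. *)
Definition metric_derivative u (t : R) : R :=
  lim (mdist (u s) (u t) / `|s - t| @[s --> t^']).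

(* The derivative of [phi \o u] makes sense for curves in the domain of [phi];
   its almost everywhere existence is part of the chain rule. *)
Definition chain_rule_inequality T phi : Prop :=
  forall u, AC_curve 2 T u ->
  (forall t, t \in `[0, T] -> edom phi (u t)) ->
  lebesgue_measure.-integrable `]0, T[
    (fun t => local_slope phi (u t) * (metric_derivative u t)%:E)%E ->
  {ae lebesgue_measure, forall t, t \in `]0, T[ ->
    derivable (fun s => fine (phi (u s))) t 1 /\
    ((`|derive1 (fun s => fine (phi (u s))) t|)%:E
       <= local_slope phi (u t) * (metric_derivative u t)%:E)%E}.

(* On the compact interval [0, T], local absolute continuity is absolute
   continuity. *)
Definition curve_of_maximal_slope T phi (u0 : X) u : Prop :=
  [/\ AC_curve 1 T u,
      {in `[0, T] &, forall s t, s <= t -> (phi (u t) <= phi (u s))%E},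
      u 0 = u0 &
      forall t, t \in `[0, T] ->
        (phi (u t)
         + 2^-1%:E * \int[lebesgue_measure]_(s in `[0%R, t])
                        (metric_derivative u s ^+ 2)%:E
         + 2^-1%:E * \int[lebesgue_measure]_(s in `[0%R, t])
                        local_slope phi (u s) ^+ 2
         = phi u0)%E].

End curves.

Section partitions.
Context {R : realType}.
Implicit Types (N : nat) (t : nat -> R) (T : R).

(* The nodes are t 0, ..., t N; further values of [t] are irrelevant. *)
Definition is_partition T N t : Prop :=
  [/\ t 0%N = 0, t N = T & forall i, (i < N)%N -> t i < t i.+1].

Definition step t (i : nat) : R := t i - t i.-1.

Definition fineness N t : R := \big[Num.max/0]_(1 <= i < N.+1) step t i.

Definition backward_interpolant (X : Type) N t (x : nat -> X) (ubar : R -> X) :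
    Prop :=
  ubar 0 = x 0%N /\
  forall j, (1 <= j <= N)%N ->
    forall r, r \in `]t j.-1, t j] -> ubar r = x j.

End partitions.

(* Main.v *)
Require Import Defs.
From HB Require Import structures.
From mathcomp Require Import all_boot all_order all_algebra.
From mathcomp Require Import all_classical all_reals all_analysis.
From mathcomp Require Import measurable_realfun.
From mathcomp Require Import ring lra.
Set Implicit Arguments.
Unset Strict Implicit.
Unset Printing Implicit Defensive.
Import Order.TTheory GRing.Theory Num.Theory.
Import numFieldTopology.Exports numFieldNormedType.Exports.
Local Open Scope classical_set_scope.
Local Open Scope ring_scope.

(* First part: the minimizer u of d^2(., v) / (2 tau) + phi works. Minimality gives
   |d phi|(u) <= d(u, v) / tau, and convexity along a geodesic from u to v gives
   phi(u) + d^2(u, v) / tau <= phi(v).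

   Second part: summing the inequalities for Ghat bounds the discrete kinetic
   energies, so the interpolants are equicontinuous up to the fineness and converge
   along a subsequence, and semicontinuity gives the energy inequality "<=" for the
   limit curve w. For the converse, convexity of the penalized functionals forces
   phi itself to be 0-geodesically convex, so that
     phi(x) - phi(y) <= |d phi|(x) d(x, y)
   for all x, y. Taking x = w(s), y = w(s + h), applying Young's inequality, averaging
   over s and letting h -> 0 yields
     phi(w(0)) - phi(w(b)) <= 1/2 \int_0^b |d phi|^2(w) + 1/2 \int_0^b |w'|^2.
   As the metric derivative is not assumed to exist, it is constructed from an
   estimate d^2(w(s), w(t)) <= (t - s) (B(t) - B(s)) with B monotone and bounded. *)

(** The function B coming from compactness is merely monotone and may jump, so it cannot serve as
    kinetic energy in the final identity; it is only a tool for constructing a speed. For each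
    rational r the function t |-> d(w r, w t) inherits the modulus of w. Its difference quotients
    are bounded in L^2, their ultrafilter limit is a charge, and Radon-Nikodym supplies a density.
    The supremum N of these densities is measurable, satisfies \int_0^b N^2 <= B(b), and equals the
    metric derivative almost everywhere.

    The two energy inequalities match for the following reason. In the one obtained by
    semicontinuity, B(b) may be lowered to \int_0^b N^2. The converse is not applied with B but with
    the monotone function b |-> \int_0^b N^2, which again controls d^2(w(s), w(t)) by
    Cauchy-Schwarz. Averaging over s avoids differentiating phi along w, about which only lower
    semicontinuity is known at that stage. *)

(** * Distance functions along curves of finite energy *)

Section shift.
Context {R : realType}.
Notation mu := (@lebesgue_measure R).
Local Open Scope ereal_scope.

Lemma measurable_shift (h : R) :
  measurable_fun [set: measurableTypeR R]
    (fun x => (x + h)%R : measurableTypeR R).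
Proof. by apply: measurable_funD => //; exact: measurable_cst. Qed.

Lemma lebesgue_measure_shift (h : R) (A : set R) : measurable A ->
  pushforward mu (fun x => (x + h)%R : measurableTypeR R) A = mu A.
Proof.
move=> mA; apply/esym/lebesgue_measure_unique => //=; [exact: measurable_shift|move=> mf _ [[a b]] _ <-].
rewrite /pushforward (_ : _ @^-1` _ = `](a - h)%R, (b - h)%R]%classic).
  rewrite !lebesgue_measure_itv/= !lte_fin ltrD2r -!EFinB.
  by case: ifP => // _; congr EFin; ring.
by apply/seteqP; split => x /=; rewrite !in_itv/= ltrBlDr lerBrDr.
Qed.

Lemma ge0_integral_shift (h a b : R) (F : R -> \bar R) :
  measurable_fun [set: R] F -> (forall x, 0 <= F x) ->
  \int[mu]_(x in `[a, b]) F (x + h)%R = \int[mu]_(x in `[(a + h)%R, (b + h)%R]) F x.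
Proof.
move=> mF F0.
transitivity (\int[pushforward mu (fun x => (x + h)%R : measurableTypeR R)]_(x in `[(a + h)%R, (b + h)%R]) F x); last first.
  apply: eq_measure_integral; [exact: measurable_shift|move=> mf A mA _].
  exact: lebesgue_measure_shift.
rewrite ge0_integral_pushforward//=; [|exact: measurable_shift|exact: measurable_funS mF].
congr (integral _ _ _); apply/seteqP; split => x /=; rewrite !in_itv/=.
  by rewrite !lerD2r.
by rewrite !lerD2r.
Qed.

(** Both sides are the integral of [F] over [a, b + h], cut at a + h and at b respectively. It is
    stated with sums because the integrals may be infinite. *)
Lemma ge0_integral_shift_split (h a b : R) (F : R -> \bar R) : (0 <= h)%R ->
  (a <= b)%R -> measurable_fun [set: R] F -> (forall x, 0 <= F x) ->
  \int[mu]_(x in `[a, b]) F (x + h)%R + \int[mu]_(x in `[a, (a + h)%R]) F x =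
  \int[mu]_(x in `[a, b]) F x + \int[mu]_(x in `[b, (b + h)%R]) F x.
Proof.
move=> h0 ab mF F0; rewrite ge0_integral_shift//.
have mFS (D : set R) : measurable_fun D F by exact: measurable_funS mF.
have cat c d e : (c <= d)%R -> (d <= e)%R ->
  \int[mu]_(x in `[c, e]) F x = \int[mu]_(x in `[c, d]) F x + \int[mu]_(x in `[d, e]) F x.
  move=> cd de.
  rewrite -(integral_itv_obnd_cbnd (mFS `]d, e]%classic)) -ge0_integral_setU//.
  - congr integral; rewrite -itv_bndbnd_setU// bnd_simp.
  - exact: mFS.
  - apply/disj_setPS => x [/=]; rewrite !in_itv/= => /andP[_ xd] /andP[].
    by rewrite ltNge xd.
rewrite addeC -cat ?lerDl ?lerD2r// -cat ?lerDl//.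
Qed.

End shift.

Section ultra.

Lemma fmap_ultra T V (f : T -> V) (F : set_system T) :
  UltraFilter F -> UltraFilter (f @ F).
Proof.
move=> FU; split; first exact: fmap_proper_filter.
move=> G GF FG; apply/seteqP; split => // A GA.
have [//|FnA] := in_ultra_setVsetC (f @^-1` A) FU.
have GnA : G (~` A) by exact: FG.
have : G (A `&` ~` A) by exact: filterI.
by rewrite setICr => /filter_not_empty.
Qed.

(** Lets all limits below be taken along one fixed ultrafilter, without extracting a subsequence for
    each set or time. *)
Lemma ultra_cvg_bounded (R : realType) T (F : set_system T) (x : T -> R) (C : R) :
  UltraFilter F -> (\forall n \near F, `|x n| <= C) -> cvg (x @ F).
Proof.
move=> FU xC; have := @segment_compact R (- C) C; rewrite compact_ultra.
move=> /(_ (x @ F) (fmap_ultra x FU)) [|p [_ xp]]; last by apply/cvg_ex; exists p.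
by apply: filterS xC => n /=; rewrite in_itv/= ler_norml.
Qed.

End ultra.

Section nd_shift.
Context {R : realType}.
Notation mu := (@lebesgue_measure R).
Local Open Scope ereal_scope.

Lemma integral_itv_le_cst (F : R -> R) (a b K : R) : (a <= b)%R ->
  measurable_fun [set: R] F -> (forall x, 0 <= F x)%R ->
  (forall x, (a <= x <= b)%R -> F x <= K)%R ->
  \int[mu]_(x in `[a, b]) (F x)%:E <= (K * (b - a))%:E.
Proof.
move=> ab mF F0 FK.
apply: (@le_trans _ _ (\int[mu]_(x in `[a, b]) (cst K%:E) x)).
  apply: ge0_le_integral => //.
  - by move=> x _; rewrite lee_fin.
  - by apply/measurable_EFinP; exact: measurable_funS mF.
rewrite integral_cst//= lebesgue_measure_itv/= lte_fin.
case: ifPn => [_|]; first by rewrite -EFinB -EFinM.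
by rewrite -leNgt => ba; rewrite mule0 lee_fin (_ : b = a) ?subrr ?mulr0//; apply/le_anti/andP.
Qed.

(** The integrals telescope: only the layer [b, b + h] survives, where [A] is at most [A (b + h)],
    while the layer at [a] is dropped because [A] is nonnegative. *)
Lemma nd_integral_shift (A : R -> R) (a b h : R) : (a <= b)%R -> (0 <= h)%R ->
  {homo A : x y / (x <= y)%R} -> (forall x, 0 <= A x)%R ->
  \int[mu]_(x in `[a, b]) (A (x + h) - A x)%:E <= (h * A (b + h))%:E.
Proof.
move=> ab h0 ndA A0.
have mA : measurable_fun [set: R] A by exact: nondecreasing_measurable.
have mAh : measurable_fun [set: R] (fun x => A (x + h)%R).
  by apply: nondecreasing_measurable => // x y xy; apply: ndA; rewrite lerD2r.
have Afin : \int[mu]_(x in `[a, b]) (A x)%:E \is a fin_num.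
  rewrite ge0_fin_numE; last by apply: integral_ge0 => x _; rewrite lee_fin.
  apply: le_lt_trans (ltry (A b * (b - a))%R).
  by apply: integral_itv_le_cst => // x /andP[_ xb]; exact: ndA.
rewrite -(leeD2rE _ _ Afin) -ge0_integralD//=; last 4 first.
- by move=> x _; rewrite lee_fin subr_ge0 ndA// lerDl.
- by apply/measurable_EFinP/measurable_funB; exact: measurable_funS measurableT _ _.
- by move=> x _; rewrite lee_fin.
- by apply/measurable_EFinP; exact: measurable_funS mA.
under eq_integral do rewrite -EFinD subrK.
have mEA : measurable_fun [set: R] (EFin \o A) by exact/measurable_EFinP.
have EA0 x : 0 <= (EFin \o A) x by rewrite lee_fin.
have /= E := ge0_integral_shift_split h0 ab mEA EA0.
apply: (@le_trans _ _ (\int[mu]_(x in `[b, (b + h)%R]) (A x)%:E +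
    \int[mu]_(x in `[a, b]) (A x)%:E)).
  by rewrite addeC -E leeDl// integral_ge0// => x _; rewrite lee_fin.
rewrite leeD2r//; have bh : (b <= b + h)%R by rewrite lerDl.
apply: le_trans (integral_itv_le_cst (K := (A (b + h))%R) bh mA A0 _) _.
  by move=> x /andP[_]; exact: ndA.
by rewrite lee_fin addrAC subrr add0r mulrC.
Qed.

End nd_shift.

(** * Functions with a quadratic modulus are primitives of integrable functions *)

Section quadratic.
Context {R : realType}.
Notation mu := (@lebesgue_measure R).
Variables (f A : R -> R) (a b K : R).
Hypotheses (f0 : forall x, 0 <= f x) (A0 : forall x, 0 <= A x)
  (AK : forall x, A x <= K) (ndA : {homo A : x y / x <= y})
  (fA : forall s t, s <= t -> (f t - f s) ^+ 2 <= (t - s) * (A t - A s)).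

Lemma quadratic_modulus s t e : 0 < e -> `|t - s| * K < e ^+ 2 ->
  `|f t - f s| < e.
Proof.
move=> e0; wlog st : s t / s <= t => [H|].
  have [st|/ltW ts] := leP s t; first exact: H.
  by rewrite distrC => /(H _ _ ts); rewrite distrC.
rewrite ger0_norm ?subr_ge0// => H.
rewrite -ltr_sqr ?nnegrE// ?(ltW e0)// real_normK ?num_real//.
apply: le_lt_trans H; apply: le_trans (fA st) _.
by rewrite ler_wpM2l ?subr_ge0// lerBlDr ler_wpDr.
Qed.

Lemma quadratic_continuous : continuous f.
Proof.
have K0 : 0 <= K by rewrite (le_trans (A0 0)).
move=> x; apply/cvgrPdist_lt => e e0.
have d0 : 0 < e ^+ 2 / (K + 1) by rewrite divr_gt0 ?exprn_gt0// ltr_wpDl.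
near=> y; rewrite distrC; apply: quadratic_modulus => //.
have : `|y - x| < e ^+ 2 / (K + 1).
  by near: y; apply/nbhs_ballP; exists (e ^+ 2 / (K + 1)) => //= z; rewrite /ball/= distrC.
rewrite ltr_pdivlMr ?ltr_wpDl//; apply: le_lt_trans.
by rewrite ler_wpM2l// lerDl.
Unshelve. all: by end_near. Qed.

Let mf : measurable_fun [set: R] f.
Proof. exact: continuous_measurable_fun quadratic_continuous. Qed.

Let h n : R := n.+1%:R^-1.
Let h_gt0 n : 0 < h n. Proof. by rewrite invr_gt0. Qed.
Let q n x := (f (x + h n) - f x) / h n.
Let mq n : measurable_fun [set: R] (q n).
Proof.
apply: measurable_funM => //; apply: measurable_funB => //.
by apply: (measurableT_comp mf); exact: measurable_shift.
Qed.

Let D : set R := `[a, b].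
Hypothesis ab : a <= b.
Let mD : measurable D. Proof. exact: measurable_itv. Qed.

(** The bound is uniform in [n]: the square of the quotient is at most [(A (x + h n) - A x) / h n],
    whose integral telescopes to at most [A (b + h n)]. *)
Let q2 n : (\int[mu]_(x in D) (q n x ^+ 2)%:E <= K%:E)%E.
Proof.
have mA : measurable_fun [set: R] A by exact: nondecreasing_measurable.
have mAh : measurable_fun [set: R] (fun x => A (x + h n)).
  by apply: nondecreasing_measurable => // x y xy; apply: ndA; rewrite lerD2r.
have Ah0 x : 0 <= A (x + h n) - A x by rewrite subr_ge0 ndA// lerDl ltW.
apply: (@le_trans _ _ (\int[mu]_(x in D) ((h n)^-1%:E * (A (x + h n) - A x)%:E)))%E.
  apply: ge0_le_integral => //.
  - by move=> x _; rewrite lee_fin sqr_ge0.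
  - by apply/measurable_EFinP/measurable_funX; exact: measurable_funS (mq n).
  - apply/measurable_EFinP; apply: measurable_funM => //.
    by apply: measurable_funB; exact: measurable_funS measurableT _ _.
  - move=> x _; rewrite lee_fin /q expr_div_n ler_pdivrMr ?exprn_gt0//.
    have /fA : x <= x + h n by rewrite lerDl ltW.
    move=> /le_trans; apply; rewrite addrAC subrr add0r expr2 mulrA.
    by rewrite (mulrC (h n)^-1) divfK ?gt_eqF// mulrC.
rewrite ge0_integralZl//=; last 3 first.
- by apply/measurable_EFinP/measurable_funB; exact: measurable_funS measurableT _ _.
- by move=> x _; rewrite lee_fin.
- by rewrite lee_fin invr_ge0 ltW.
apply: (@le_trans _ _ ((h n)^-1%:E * (h n * A (b + h n))%:E))%E.
  by rewrite lee_wpmul2l ?lee_fin ?invr_ge0 ?(ltW (h_gt0 n))// nd_integral_shift// ltW.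
by rewrite -EFinM lee_fin mulrA mulVf ?gt_eqF// mul1r.
Qed.

Let J n (E : set R) := (\int[mu]_(x in E `&` D) (q n x)%:E)%E.

Let mqS n (E : set R) : measurable_fun E (EFin \o q n).
Proof. by apply/measurable_EFinP; exact: measurable_funS (mq n). Qed.

(* Young's inequality |q| <= 1/d + d q^2. *)
Let Jbound n E d : measurable E -> 0 < d ->
  (\int[mu]_(x in E `&` D) `|(q n x)%:E| <= d^-1%:E * mu (E `&` D) + (d * K)%:E)%E.
Proof.
move=> mE d0; have mED : measurable (E `&` D) by exact: measurableI.
apply: (@le_trans _ _ (\int[mu]_(x in E `&` D) (d^-1%:E + d%:E * (q n x ^+ 2)%:E)))%E.
  apply: ge0_le_integral => //.
  - by apply: (measurableT_comp (f := abse)) => //; exact: mqS.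
  - apply/measurable_EFinP; apply: measurable_funD => //; apply: measurable_funM => //.
    by apply: measurable_funX; exact: measurable_funS (mq n).
  - move=> x _; rewrite -EFinM -EFinD lee_fin -[q n x ^+ 2]real_normK ?num_real//.
    have : 0 <= `|q n x| by []; move: `|q n x| => y y0.
    have [yd|/ltW dy] := leP y d^-1; first by rewrite ler_wpDr// mulr_ge0 ?sqr_ge0// ltW.
    rewrite ler_wpDl ?invr_ge0 ?(ltW d0)// expr2 mulrA ler_peMl//.
    by rewrite -ler_pdivrMl// mulr1.
rewrite ge0_integralD//=; last 3 first.
- by move=> x _; rewrite lee_fin invr_ge0 ltW.
- by move=> x _; rewrite lee_fin mulr_ge0 ?sqr_ge0// ltW.
- apply/measurable_EFinP; apply: measurable_funM => //.
  by apply: measurable_funX; exact: measurable_funS (mq n).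
rewrite integral_cst// leeD2l// ge0_integralZl//=; last 3 first.
- by apply/measurable_EFinP/measurable_funX; exact: measurable_funS (mq n).
- by move=> x _; rewrite lee_fin sqr_ge0.
- by rewrite lee_fin ltW.
rewrite EFinM lee_wpmul2l ?lee_fin ?(ltW d0)//; apply: le_trans (q2 n).
apply: ge0_subset_integral => //.
- by apply/measurable_EFinP/measurable_funX; exact: measurable_funS (mq n).
- by move=> x _; rewrite lee_fin sqr_ge0.
Qed.

Let muED_fin (E : set R) : measurable E -> mu (E `&` D) \is a fin_num.
Proof.
move=> mE; rewrite ge0_fin_numE//; apply: (@le_lt_trans _ _ (mu D)).
  by rewrite le_measure ?inE//; exact: measurableI.
by rewrite lebesgue_measure_itv/=; case: ifP => _; rewrite ?ltry// -EFinB ltry.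
Qed.

Let Jint n (E : set R) : measurable E -> mu.-integrable (E `&` D) (EFin \o q n).
Proof.
move=> mE; apply/integrableP; split; first exact: mqS.
apply: le_lt_trans (Jbound n mE ltr01) _.
by rewrite -(fineK (muED_fin mE)) -EFinM -EFinD ltry.
Qed.

Let c n (E : set R) := fine (J n E).

Let cJ n (E : set R) : measurable E -> (c n E)%:E = J n E.
Proof.
move=> mE; rewrite fineK//; apply: integrable_fin_num; last exact: Jint.
exact: measurableI.
Qed.

Let c_bound n (E : set R) d : measurable E -> 0 < d ->
  `|c n E| <= d^-1 * fine (mu (E `&` D)) + d * K.
Proof.
move=> mE d0; have mED : measurable (E `&` D) by exact: measurableI.
rewrite -lee_fin EFinD [in leRHS]EFinM fineK ?muED_fin// -abse_EFin cJ//.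
by apply: le_trans (Jbound n mE d0); apply: le_abse_integral => //; exact: mqS.
Qed.

Let c_add n (E F : set R) : measurable E -> measurable F -> E `&` F = set0 ->
  c n (E `|` F) = c n E + c n F.
Proof.
move=> mE mF EF; apply: EFin_inj; rewrite EFinD !cJ//; last exact: measurableU.
rewrite /J setIUl integral_setU//.
- exact: measurableI.
- exact: measurableI.
- exact: mqS.
- by apply/disj_setPS => x [[Ex _] [Fx _]]; rewrite -EF.
Qed.

Variable U : set_system nat.
Hypotheses (UU : UltraFilter U) (ooU : \oo `<=` U).

(* The difference quotients of f are bounded in L^2, so the set function
   E |-> lim_U \int_E q n is a charge dominated by mu, whose density is f'. *)
Let C (E : set R) : R := lim (c n E @[n --> U]).

Let cvgC (E : set R) : measurable E -> c n E @[n --> U] --> C E.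
Proof.
move=> mE; apply: (@ultra_cvg_bounded _ _ _ _ (1^-1 * fine (mu (E `&` D)) + 1 * K)).
by apply: filterE => n; exact: c_bound.
Qed.

Let C_bound (E : set R) d : measurable E -> 0 < d ->
  `|C E| <= d^-1 * fine (mu (E `&` D)) + d * K.
Proof.
move=> mE d0; have H : `|c n E| @[n --> U] --> `|C E| by apply: cvg_norm; exact: cvgC.
rewrite -(cvg_lim _ H)//; apply: limr_le; first exact: cvgP H.
by apply: filterE => n; exact: c_bound.
Qed.

Let C_add (E F : set R) : measurable E -> measurable F -> E `&` F = set0 ->
  C (E `|` F) = C E + C F.
Proof.
move=> mE mF EF; apply/cvg_lim => //.
under eq_fun do rewrite c_add//.
by apply: cvgD; exact: cvgC.
Qed.

Let C0 : C set0 = 0.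
Proof.
have := C_add measurable0 measurable0 (set0I set0).
by rewrite setU0 => /eqP; rewrite -subr_eq subrr eq_sym => /eqP.
Qed.

Let nu (E : set R) : \bar R := (C E)%:E.

(** Finite additivity survives the limit along [U]. For countable additivity the tails [T n] must
    carry vanishing charge: their measure within [D] tends to 0, and [C_bound] turns this into
    smallness of [C], which is the equi-integrability of the quotients. *)
Let nu_sigma_additive : semi_sigma_additive nu.
Proof.
move=> F mF tF mUF.
pose T n := \bigcup_(k in [set k | (n <= k)%N]) F k.
have mT n : measurable (T n) by exact: bigcup_measurable.
have TS n : T n = F n `|` T n.+1.
  apply/seteqP; split => x.
    move=> [k /= nk Fx]; move: nk; rewrite leq_eqVlt => /predU1P[->|nk]; first by left.
    by right; exists k.
  move=> [Fx|[k /= nk Fx]]; first by exists n => /=.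
  by exists k => //=; exact: ltnW.
have FT n : F n `&` T n.+1 = set0.
  rewrite -subset0 => x [Fx [k /= nk Fkx]].
  move/trivIsetP : tF => /(_ n k I I); rewrite ltn_eqF// => /(_ isT).
  by rewrite -subset0; apply; split; [exact: Fx|exact: Fkx].
have CT n : C (\bigcup_k F k) = \sum_(0 <= k < n) C (F k) + C (T n).
  elim: n => [|n IH].
    by rewrite big_geq// add0r /T; congr (C _); apply: eq_bigcupl; split => // k.
  by rewrite IH big_nat_recr//= TS C_add// addrA.
have T0 : (mu (T n `&` D)) @[n --> \oo] --> 0%E.
  have -> : 0%E = mu (\bigcap_n (T n `&` D)).
    rewrite (_ : bigcap _ _ = set0) ?measure0// -subset0 => x H.
    have [[k _ Fx] _] := H 0%N I.
    have [[j /= kj Fjx] _] := H k.+1 I.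
    have : (F k `&` T k.+1) x by split => //; exists j.
    by rewrite FT.
  apply: nonincreasing_cvg_mu.
  - by rewrite -ge0_fin_numE// muED_fin.
  - by move=> n; apply: measurableI; [exact: mT|exact: mD].
  - apply: bigcap_measurable; first by exists 0%N.
    by move=> n _; apply: measurableI; [exact: mT|exact: mD].
  - move=> m n mn; apply/subsetPset => x [[k /= nk Fx] Dx]; split => //.
    by exists k => //=; exact: leq_trans nk.
under eq_fun do rewrite sumEFin.
apply/cvg_EFin; first by apply: nearW.
apply/cvgrPdist_lt => e e0 /=.
have K0 : 0 <= K by rewrite (le_trans (A0 0)).
(* The parameter [d] is fixed first, making the term [d * K] small; only then is [n] taken large.
   The denominator has [K + 1] because [K] may be 0. *)
pose d := e / (2 * (K + 1)).
have d0 : 0 < d by rewrite divr_gt0// mulr_gt0// ltr_wpDl.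
have dK : d * K < e / 2.
  rewrite /d invfM mulrA -mulrA gtr_pMr ?divr_gt0//.
  by rewrite mulrC ltr_pdivrMr ?ltr_wpDl// mul1r ltrDl.
have : fine (mu (T n `&` D)) @[n --> \oo] --> 0 by exact: fine_cvg T0.
move=> /cvgrPdist_lt/(_ (d * (e / 2))) [|N _ H]; first by rewrite mulr_gt0// divr_gt0.
exists N => // n /= /H; rewrite sub0r normrN ger0_norm ?fine_ge0// => Hn.
rewrite (CT n) addrAC subrr add0r; apply: le_lt_trans (C_bound _ d0) _ => //.
by rewrite [ltRHS](splitr e) ltrD// mulrC ltr_pdivrMr// mulrC.
Qed.

Let nu0 : nu set0 = 0%E. Proof. by rewrite /nu C0. Qed.

(** On a null set only the term [d * K] of [C_bound] remains, and [d] is arbitrary. *)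
Let nu_dom : nu `<< mu.
Proof.
apply/null_content_dominatesP => E mE E0; rewrite /nu; congr EFin.
apply/eqP; rewrite -normr_le0; apply/ler_addgt0Pr => e e0; rewrite add0r.
have K0 : 0 <= K by rewrite (le_trans (A0 0)).
have d0 : 0 < e / (K + 1) by rewrite divr_gt0// ltr_wpDl.
apply: le_trans (C_bound mE d0) _.
have -> : mu (E `&` D) = 0%E.
  apply/eqP; rewrite eq_le measure_ge0 andbT -E0 le_measure ?inE//.
  exact: measurableI.
rewrite /= mulr0 add0r -mulrA ger_pMr// mulrC ler_pdivrMr ?ltr_wpDl//.
by rewrite mul1r lerDl.
Qed.

Lemma limit_charge_density : exists k : R -> R,
  mu.-integrable [set: R] (EFin \o k) /\
  forall E, measurable E ->
    (\int[mu]_(x in E) (k x)%:E)%E = (C E)%:E.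
Proof.
pose nu' : set (measurableTypeR R) -> \bar R := nu.
have nu'_fin (E : set (measurableTypeR R)) : measurable E -> nu' E \is a fin_num by [].
have nu'_add : semi_sigma_additive nu' by exact: nu_sigma_additive.
pose m := isCharge.Build _ _ _ nu' nu0 nu'_fin nu'_add.
pose nuc : {charge set (measurableTypeR R) -> \bar R} := HB.pack nu' m.
have nuc_dom : nuc `<< mu by exact: nu_dom.
pose k := Radon_Nikodym nuc mu.
have kfin x : k x \is a fin_num by exact: Radon_Nikodym_fin_num.
have kE : EFin \o (fine \o k) = k by apply/funext => x /=; rewrite fineK.
exists (fine \o k); split; first by rewrite kE; exact: Radon_Nikodym_integrable.
move=> E mE; transitivity (nuc E) => //.
rewrite (Radon_Nikodym_integral nuc_dom mE).
by apply: eq_integral => x _; exact: (congr1 (@^~ x) kE).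
Qed.

Let If (u v : R) : mu.-integrable `[u, v] (EFin \o f).
Proof.
apply: continuous_compact_integrable; first exact: segment_compact.
by apply: continuous_subspaceT => x; exact: quadratic_continuous.
Qed.

Let avg_cvg (t : R) : (h n)^-1 * (\int[mu]_(x in `[t, t + h n]) f x)%R @[n --> \oo] --> f t.
Proof.
apply/cvgrPdist_le => e e0.
have /cvgrPdist_le/(_ e e0)/nbhs_ballP[d /= d0 H] := @quadratic_continuous t.
near=> n.
have hd : h n < d by near: n; exact: near_infty_natSinv_lt (PosNum d0).
have tth : t <= t + h n by rewrite lerDl ltW.
have mt : fine (mu `[t, t + h n]) = h n.
  rewrite lebesgue_measure_itv/= lte_fin ltrDl h_gt0/=.
  by rewrite addrAC subrr add0r.
have B x : `[t, (t + h n)]%classic x -> `|f t - f x| <= e.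
  rewrite /= in_itv/= => /andP[tx xt]; apply: H.
  by rewrite /ball/= ltr_distl; apply/andP; split; lra.
have cint r : mu.-integrable `[t, t + h n] (EFin \o cst r).
  apply: continuous_compact_integrable; first exact: segment_compact.
  by apply: continuous_subspaceT => x; exact: cvg_cst.
have mI : measurable (`[t, (t + h n)]%classic : set R) by exact: measurable_itv.
have cstE r : (\int[mu]_(x in `[t, t + h n]) r)%R = r * h n.
  by rewrite Rintegral_cst// mt.
have ub : (\int[mu]_(x in `[t, t + h n]) f x <= (f t + e) * h n)%R.
  rewrite -cstE; apply: le_Rintegral => //; try exact: If; try exact: cint.
  by move=> x /B; rewrite ler_distl => /andP[]; lra.
have lb : ((f t - e) * h n <= \int[mu]_(x in `[t, t + h n]) f x)%R.
  rewrite -cstE; apply: le_Rintegral => //; try exact: If; try exact: cint.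
  by move=> x /B; rewrite ler_distl => /andP[]; lra.
rewrite ler_distl; apply/andP; split.
  by rewrite lerBlDr ler_pdivrMl// mulrC.
by rewrite -lerBlDr ler_pdivlMl// mulrC.
Unshelve. all: by end_near. Qed.

(** The integral of [q n] over [s, t] is the average of [f] over [t, t + h n] minus that over
    [s, s + h n], and these averages converge by continuity. *)
Lemma limit_charge_interval s t : a <= s -> s <= t -> t <= b ->
  C `[s, t] = f t - f s.
Proof.
move=> sa st tb; apply/cvg_lim => //.
have mI (u v : R) : measurable (`[u, v]%classic : set R) by exact: measurable_itv.
suff -> : c ^~ `[s, t]%classic = (fun n =>
    (h n)^-1 * (\int[mu]_(x in `[t, t + h n]) f x)%R -
    (h n)^-1 * (\int[mu]_(x in `[s, s + h n]) f x)%R).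
  by apply: cvgB => B /avg_cvg; exact: ooU.
apply/funext => n; rewrite -mulrBr.
have -> : c n `[s, t] = (\int[mu]_(x in `[s, t]) q n x)%R.
  rewrite /c /J /Rintegral; congr (fine (integral _ _ _)).
  apply/seteqP; split => x /= []; rewrite ?in_itv/= => /andP[? ?]; rewrite ?in_itv/=.
    by move=> _; apply/andP.
  by split; apply/andP; split; [| |exact: le_trans sa _|exact: le_trans tb].
have fh0 : 0 <= h n by rewrite ltW.
have mEf : measurable_fun [set: R] (EFin \o f) by exact/measurable_EFinP.
have Ef0 x : (0 <= (EFin \o f) x)%E by rewrite lee_fin.
have /= E := ge0_integral_shift_split fh0 st mEf Ef0.
have Ish : mu.-integrable `[s, t] (EFin \o (fun x => f (x + h n))).
  apply: continuous_compact_integrable; first exact: segment_compact.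
  apply: continuous_subspaceT => x; apply: continuous_comp.
    by apply: cvgD; [exact: cvg_id|exact: cvg_cst].
  exact: quadratic_continuous.
have E' : (\int[mu]_(x in `[s, t]) f (x + h n)%R + \int[mu]_(x in `[s, (s + h n)%R]) f x =
   \int[mu]_(x in `[s, t]) f x + \int[mu]_(x in `[t, (t + h n)%R]) f x)%R.
  rewrite /Rintegral -!fineD ?integrable_fin_num//; by rewrite E.
transitivity ((h n)^-1 * (\int[mu]_(x in `[s, t]) f (x + h n) - \int[mu]_(x in `[s, t]) f x))%R.
  rewrite mulrC -RintegralB//.
  rewrite -RintegralZr//; last by apply: (integrableB _ Ish (If _ _)).
by congr *%R; apply/eqP; rewrite subr_eq addrAC eq_sym subr_eq E' addrC.
Qed.

End quadratic.

Theorem quadratic_density (R : realType) (f A : R -> R) (a b K : R) :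
  (forall x, 0 <= f x) -> (forall x, 0 <= A x) -> (forall x, A x <= K) ->
  {homo A : x y / x <= y} ->
  (forall s t, s <= t -> (f t - f s) ^+ 2 <= (t - s) * (A t - A s)) ->
  a <= b ->
  exists k : R -> R, lebesgue_measure.-integrable [set: R] (EFin \o k) /\
    forall s t, a <= s -> s <= t -> t <= b ->
      (\int[lebesgue_measure]_(x in `[s, t]) (k x)%:E = (f t - f s)%:E)%E.
Proof.
move=> f0 A0 AK ndA fA ab.
have [U [UU ooU]] := ultraFilterLemma (eventually_filter : ProperFilter \oo).
have [k [ki kE]] := limit_charge_density A0 AK ndA fA ab UU.
exists k; split=> // s t sa st tb; rewrite kE; last exact: measurable_itv.
by rewrite (limit_charge_interval f0 A0 AK fA UU ooU).
Qed.

(** * Metric derivative *)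

Section limn_einf.
Context {R : realType}.
Local Open Scope ereal_scope.

Lemma le_limn_einf (u v : (\bar R)^nat) : (forall n, u n <= v n) ->
  limn_einf u <= limn_einf v.
Proof.
move=> uv; rewrite !limn_einf_lim; apply: lee_lim.
- exact: is_cvg_einfs.
- exact: is_cvg_einfs.
- apply: nearW => n; apply: le_ereal_inf_tmp => _ [k nk <-].
  by apply: le_trans (uv k); apply: ereal_inf_lbound; exists k.
Qed.

Lemma limn_einf_le (v : (\bar R)^nat) c : (forall n, v n <= c) ->
  limn_einf v <= c.
Proof.
move=> vc; rewrite -[leRHS](cvg_limn_einf_sup (cvg_cst c)).1.
exact: le_limn_einf.
Qed.

Lemma limn_einf_ge_cvg (u v : (\bar R)^nat) l : (forall n, u n <= v n) ->
  u @ \oo --> l -> l <= limn_einf v.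
Proof. by move=> uv /cvg_limn_einf_sup[<- _]; exact: le_limn_einf. Qed.

Lemma limn_einf_ge0 (v : (\bar R)^nat) : (forall n, 0 <= v n) -> 0 <= limn_einf v.
Proof. by move=> v0; apply: (limn_einf_ge_cvg v0); exact: cvg_cst. Qed.

Lemma measurable_fun_limn_einf d (T : measurableType d) (D : set T)
    (f : (T -> \bar R)^nat) : (forall n, measurable_fun D (f n)) ->
  measurable_fun D (fun x => limn_einf (f ^~ x)).
Proof.
move=> mf.
rewrite (_ : (fun x => _) = (fun x => - limn_esup (fun n => - f n x))).
  apply: measurableT_comp => //; apply: measurable_fun_limn_esup => n.
  exact: measurableT_comp.
by apply/funext => x; rewrite -limn_einfN; congr limn_einf; apply/funext => n /=; rewrite oppeK.
Qed.

End limn_einf.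

Section derivative.
Context {R : realType}.

Lemma derivable_quotient (F : R -> R) (t e : R) : derivable F t 1 -> 0 < e ->
  exists2 d, 0 < d & forall s, s != t -> `|s - t| < d ->
    `|(F s - F t) / (s - t) - derive1 F t| < e.
Proof.
move=> dF e0; have := dF; rewrite /derivable => /cvg_ex [l Fl].
have -> : derive1 F t = l by rewrite derive1E; exact/cvg_lim.
move/cvgrPdist_lt : Fl => /(_ e e0) [d /= d0 H].
exists d => // s st sd.
have := H (s - t); rewrite /ball_ /= sub0r normrN subr_eq0 => /(_ sd st).
by rewrite distrC [_ *: 1]mulr1 subrK [_ *: _]mulrC.
Qed.

End derivative.

Section lebesgue_ae.
Context {R : realType}.
Notation mu := (@lebesgue_measure R).

Lemma lebesgue_aeS (P Q : R -> Prop) : (forall x, P x -> Q x) ->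
  {ae mu, forall x, P x} -> {ae mu, forall x, Q x}.
Proof. by move=> PQ; apply: filterS; first exact: (ae_filter_ringOfSetsType mu). Qed.

Lemma lebesgue_aeS2 (P Q S : R -> Prop) : (forall x, P x -> Q x -> S x) ->
  {ae mu, forall x, P x} -> {ae mu, forall x, Q x} -> {ae mu, forall x, S x}.
Proof. by move=> PQ; apply: filterS2; first exact: (ae_filter_ringOfSetsType mu). Qed.

End lebesgue_ae.

Section metric_speed.
Context {R : realType} {X : metricType R}.
Notation mu := (@lebesgue_measure R).
Variables (w : R -> X) (A : R -> R) (K T : R).
Hypotheses (A0 : forall x, 0 <= A x) (AK : forall x, A x <= K)
  (ndA : {homo A : x y / x <= y})
  (wA : forall s t, s <= t -> mdist (w s) (w t) ^+ 2 <= (t - s) * (A t - A s))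
  (T0 : 0 <= T).

(* The metric speed is the supremum of the |(d(w r, w t))'| over the rationals r. *)
Let ratn (n : nat) : R := ratr (odflt 0 (unpickle n)).
Let f n t := mdist (w (ratn n)) (w t).

Let f_lip n s t : `|f n t - f n s| <= mdist (w s) (w t).
Proof.
rewrite /f ler_norml; apply/andP; split.
  rewrite lerNl opprB lerBlDr addrC metric_sym [mdist (w s) (w t)]metric_sym.
  by rewrite [leLHS]metric_sym; exact: metric_triangle.
rewrite lerBlDr addrC; exact: metric_triangle.
Qed.

Let fA n s t : s <= t -> (f n t - f n s) ^+ 2 <= (t - s) * (A t - A s).
Proof.
move=> /wA; apply: le_trans; rewrite -[leLHS]real_normK ?num_real//.
by rewrite ler_sqr ?nnegrE// ?mdist_ge0.
Qed.

Let density n : exists k : R -> R, mu.-integrable [set: R] (EFin \o k) /\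
    forall s t, 0 <= s -> s <= t -> t <= T ->
      (\int[mu]_(x in `[s, t]) (k x)%:E = (f n t - f n s)%:E)%E.
Proof.
by apply: (quadratic_density _ A0 AK ndA _ T0) => [x|]; [exact: mdist_ge0|exact: fA].
Qed.

Let k n := sval (cid (density n)).
Let k_int n : mu.-integrable [set: R] (EFin \o k n).
Proof. by have [] := svalP (cid (density n)). Qed.
Let kE n s t : 0 <= s -> s <= t -> t <= T ->
  (\int[mu]_(x in `[s, t]) (k n x)%:E = (f n t - f n s)%:E)%E.
Proof. by have [_] := svalP (cid (density n)); exact. Qed.
Let mk n : measurable_fun [set: R] (k n).
Proof. by have /measurable_int/measurable_EFinP := k_int n. Qed.

(** At a Lebesgue point of [k n] the primitive of [k n] is differentiable. As there are countably
    many [n], one null set serves them all. *)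
Let k_derive : {ae mu, forall t, 0 < t < T -> forall n e, 0 < e ->
  exists2 d, 0 < d & forall s, s != t -> `|s - t| < d ->
    `|(f n s - f n t) / (s - t) - k n t| < e}.
Proof.
have : {ae mu, forall t, forall n, lebesgue_pt (k n) t}.
  apply: ae_foralln => n; apply: lebesgue_differentiation.
  by apply: open_integrable_locally => //; exact: openT.
apply: lebesgue_aeS => t kt /andP[t0 tT] n e e0.
pose F (y : R) := (\int[mu]_(x in [set` `[0%R, y]]) (k n x))%R.
have [dF F't] : derivable F t 1 /\ derive1 F t = k n t.
  apply: (@FTC1_lebesgue_pt _ (k n) (BLeft 0) t T) => //.
  exact: integrableS (k_int n).
have [d d0 H] := derivable_quotient dF e0.
(* The bound by [t] and [T - t] keeps [s] in [0, T], where the primitive agrees with [f n] up to a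
   constant. *)
have m0 : 0 < Num.min d (Num.min t (T - t)) by rewrite !lt_min d0 t0 subr_gt0.
exists (Num.min d (Num.min t (T - t))) => // s st; rewrite !lt_min => /and3P[sd s1 s2].
have FE y : 0 <= y <= T -> F y = f n y - f n 0.
  by move=> /andP[y0 yT]; rewrite /F /Rintegral kE.
move: (H s st sd); rewrite F't !FE; last 2 first.
- by rewrite !ltW.
- move: s1 s2; rewrite !ltr_norml => /andP[? ?] /andP[? ?]; apply/andP; split; lra.
by rewrite opprB addrA subrK.
Qed.

Let Ne t : \bar R := ereal_sup (range (fun n => `|(k n t)%:E|%E)).

Let mNe : measurable_fun [set: R] Ne.
Proof.
rewrite (_ : Ne = (fun t => esups (fun n => `|(k n t)%:E|%E) 0)).
  apply: measurable_fun_esups => n; apply: measurableT_comp => //.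
  exact/measurable_EFinP.
apply/funext => t; rewrite /Ne /esups; congr ereal_sup.
by apply/seteqP; split => x [n _ <-]; exists n.
Qed.

Let h (j : nat) : R := j.+1%:R^-1.
Let h_gt0 j : 0 < h j. Proof. by rewrite invr_gt0. Qed.
Let v j t : \bar R := ((h j)^-1 * (A t - A (t - h j)))%:E.
Let v_ge0 j t : (0 <= v j t)%E.
Proof. by rewrite lee_fin mulr_ge0 ?invr_ge0 ?(ltW (h_gt0 j))// subr_ge0 ndA// gerBl ltW. Qed.
Let mA : measurable_fun [set: R] A.
Proof. exact: nondecreasing_measurable. Qed.
Let mAh (j : nat) : measurable_fun [set: R] (fun t => A (t - h j)).
Proof. by apply: nondecreasing_measurable => // x y xy; apply: ndA; rewrite lerD2r. Qed.
Let mv j : measurable_fun [set: R] (v j).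
Proof. by apply/measurable_EFinP; apply: measurable_funM => //; apply: measurable_funB. Qed.

(** A substitute for the derivative of [A]: a lower limit of difference quotients exists everywhere
    and is measurable, so differentiability of monotone functions is not called upon. *)
Let L t := limn_einf (v ^~ t).
Let mL : measurable_fun [set: R] L.
Proof. exact: measurable_fun_limn_einf. Qed.
Let L_ge0 t : (0 <= L t)%E. Proof. exact: limn_einf_ge0. Qed.

Let int_L b : 0 <= b -> (\int[mu]_(t in `[0%R, b]) L t <= (A b)%:E)%E.
Proof.
move=> b0.
apply: (@le_trans _ _ (limn_einf (fun j => \int[mu]_(t in `[0%R, b]) v j t))%E).
  by apply: fatou => // n; exact: measurable_funS (mv n).
apply: limn_einf_le => j.
pose F t : \bar R := (A t - A (t - h j))%:E.
have mF : measurable_fun [set: R] F by apply/measurable_EFinP/measurable_funB.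
have F0 t : (0 <= F t)%E by rewrite lee_fin subr_ge0 ndA// gerBl ltW.
under eq_integral do rewrite /v EFinM -/(F _).
rewrite ge0_integralZl//=; last 2 first.
- exact: measurable_funS mF.
- by rewrite lee_fin invr_ge0 ltW.
rewrite -lee_pdivlMl ?invr_gt0// invrK.
(* The quotients in [v] look backward. After the shift the increments are forward ones on
   [-h, b - h], so the telescoped bound is [A b] itself and not a value of [A] beyond [b]. *)
have := ge0_integral_shift (h j) (- h j) (b - h j) mF F0.
rewrite addNr subrK => <-.
under eq_integral do rewrite /F addrK.
have := @nd_integral_shift R A (- h j) (b - h j) (h j).
rewrite subrK EFinM; apply => //; last exact: ltW.
by rewrite lerBrDr addNr.
Qed.

(** [k n t] is the limit of the backward quotients of [f n], whose squares are at most [v j t] by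
    the quadratic modulus. *)
Let k_le_L : {ae mu, forall t, 0 < t < T -> forall n, ((k n t ^+ 2)%:E <= L t)%E}.
Proof.
apply: (lebesgue_aeS _ k_derive) => t H tT n; have {}H := H tT n.
pose q j := (f n (t - h j) - f n t) / (t - h j - t).
have qE j : t - h j - t = - h j by rewrite addrAC subrr add0r.
have qk : q j @[j --> \oo] --> k n t.
  apply/cvgrPdist_lt => e e0; have [d d0 Hd] := H e e0.
  near=> j; rewrite distrC; apply: Hd.
    by rewrite -subr_eq0 qE oppr_eq0 gt_eqF.
  rewrite qE normrN gtr0_norm//.
  by near: j; exact: near_infty_natSinv_lt (PosNum d0).
apply: (@limn_einf_ge_cvg _ (fun j => (q j ^+ 2)%:E)).
  move=> j; rewrite /q /v lee_fin qE expr_div_n sqrrN ler_pdivrMr ?exprn_gt0//.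
  have /fA : t - h j <= t by rewrite gerBl ltW.
  move=> /(_ n); rewrite -(sqrrN (f n t - _)) opprB => /le_trans; apply.
  rewrite opprB addrCA subrr addr0 expr2 mulrA (mulrC (h j)^-1) divfK ?gt_eqF//.
  by rewrite mulrC.
apply: cvg_EFin; first exact: nearW.
by rewrite expr2; apply: cvgM.
Unshelve. all: by end_near. Qed.

Let L_fin : {ae mu, forall t, 0 < t < T -> (L t < +oo)%E}.
Proof.
have : mu.-integrable `[0, T] L.
  apply/integrableP; split; first exact: measurable_funS mL.
  under eq_integral do rewrite gee0_abs//.
  by apply: le_lt_trans (int_L T0) _; rewrite ltry.
move=> /integrable_ae => /(_ (measurable_itv _)); apply: lebesgue_aeS => t Lt /andP[t0 tT].
by rewrite -ge0_fin_numE//; apply: Lt; rewrite /= in_itv/= !ltW.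
Qed.

(** On ]0, T[ the value [+oo] of [Ne], which [fine] sends to 0, occurs only on a null set. Vanishing
    outside [0, T] makes [N] integrable over R, as needed for Lebesgue differentiation. *)
Let N t : R := if 0 <= t <= T then fine (Ne t) else 0.

Let Ne_ge0 t : (0 <= Ne t)%E.
Proof. by apply: (@le_trans _ _ `|(k 0%N t)%:E|%E) => //; apply: ereal_sup_ubound; exists 0%N. Qed.

Let N_ge0 t : 0 <= N t.
Proof. by rewrite /N; case: ifP => // _; exact: fine_ge0. Qed.

Let mN : measurable_fun [set: R] N.
Proof.
rewrite (_ : N = (fine \o Ne) \_ (`[0, T]%classic : set R)).
  apply/(measurable_restrictT _ _).1 => //.
  by apply: measurableT_comp => //; exact: measurable_funS mNe.
apply/funext => t; rewrite /N patchE; case: ifPn => H.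
  by rewrite mem_set//= in_itv.
by rewrite memNset//= in_itv/=; exact/negP.
Qed.

Let NeN : {ae mu, forall t, 0 < t < T -> Ne t = (N t)%:E /\ ((N t ^+ 2)%:E <= L t)%E}.
Proof.
apply: (lebesgue_aeS2 _ L_fin k_le_L) => t Lfin kL tT.
have {}Lfin := Lfin tT; have {}kL := kL tT.
have Lf : L t \is a fin_num by rewrite ge0_fin_numE.
have NeL : (Ne t <= (Num.sqrt (fine (L t)))%:E)%E.
  apply: ge_ereal_sup => _ [n _ <-]; rewrite abse_EFin lee_fin.
  rewrite -sqrtr_sqr ler_wsqrtr// -lee_fin fineK//.
have Nef : Ne t \is a fin_num by rewrite ge0_fin_numE// (le_lt_trans NeL)// ltry.
have NE : Ne t = (N t)%:E.
  by rewrite /N; move/andP: tT => [t0 tT]; rewrite !ltW//= fineK.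
split => //; rewrite -(fineK Lf) lee_fin -[leRHS]sqr_sqrtr ?fine_ge0//.
by rewrite ler_sqr ?nnegrE ?sqrtr_ge0// -lee_fin -NE.
Qed.

Let N2_le b : 0 <= b -> b <= T -> (\int[mu]_(t in `[0%R, b]) (N t ^+ 2)%:E <= (A b)%:E)%E.
Proof.
move=> b0 bT; apply: le_trans (int_L b0).
have mN2 (D : set R) : measurable_fun D (fun t => (N t ^+ 2)%:E).
  by apply/measurable_EFinP/measurable_funX; exact: measurable_funS mN.
(* The pointwise estimate is available inside ]0, T[ only, so the end points are removed from the
   domain. *)
rewrite (integral_itv_bndoo _ _ (mN2 _)) [leRHS]integral_itv_bndoo; last first.
  exact: measurable_funS mL.
apply: ae_ge0_le_integral => //.
- by move=> t _; rewrite lee_fin sqr_ge0.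
- exact: mN2.
- exact: measurable_funS mL.
- apply: (lebesgue_aeS _ NeN) => t H; rewrite /= in_itv/= => /andP[t0 tb].
  by apply: (H _).2; rewrite t0 (lt_le_trans tb).
Qed.

Let N_int : mu.-integrable [set: R] (EFin \o N).
Proof.
have NE : EFin \o N = (EFin \o N) \_ (`[0, T]%classic : set R).
  apply/funext => t; rewrite patchE; case: ifPn => //.
  by rewrite notin_setE/= in_itv/= /N => /negP/negbTE ->.
have mI : measurable (`[0, T]%classic : set R) by exact: measurable_itv.
have := (integrable_mkcond (mu := mu) (EFin \o N) mI).1; rewrite -NE; apply.
apply/integrableP; split.
  by apply/measurable_EFinP; exact: measurable_funS mN.
apply: (@le_lt_trans _ _ (\int[mu]_(t in `[0%R, T]) (1%:E + (N t ^+ 2)%:E))%E).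
  apply: ge0_le_integral => //.
  - apply: (measurableT_comp (f := abse)) => //.
    by apply/measurable_EFinP; exact: measurable_funS mN.
  - apply/measurable_EFinP; apply: measurable_funD => //.
    by apply: measurable_funX; exact: measurable_funS mN.
  - move=> t _; rewrite /= lee_fin ger0_norm//; have := N_ge0 t; nra.
rewrite ge0_integralD//=; last 2 first.
- by move=> t _; rewrite lee_fin sqr_ge0.
- by apply/measurable_EFinP/measurable_funX; exact: measurable_funS mN.
rewrite integral_cst//= lebesgue_measure_itv/=; apply: lte_add_pinfty.
  by rewrite mul1e; case: ifP => _; rewrite ?ltry// -EFinB ltry.
by apply: le_lt_trans (N2_le T0 (lexx T)) _; rewrite ltry.
Qed.

Let w_modulus s t e : 0 < e -> `|t - s| * K < e ^+ 2 -> mdist (w s) (w t) < e.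
Proof.
move=> e0; wlog st : s t / s <= t => [H|].
  have [st|/ltW ts] := leP s t; first exact: H.
  by rewrite distrC metric_sym => /(H _ _ ts).
rewrite ger0_norm ?subr_ge0// => H.
rewrite -ltr_sqr ?nnegrE ?mdist_ge0// ?(ltW e0)//.
apply: le_lt_trans H; apply: le_trans (wA st) _.
by rewrite ler_wpM2l ?subr_ge0// lerBlDr ler_wpDr.
Qed.

(** For a rational time r close to t, the distance d(w s, w t) exceeds the increment of d(w r, .) by
    at most 2 d(w r, w t) < e, and the density of that increment is bounded by [N]. *)
Let dist_le s t : 0 <= s -> s <= t -> t <= T ->
  ((mdist (w s) (w t))%:E <= \int[mu]_(x in `[s, t]) (N x)%:E)%E.
Proof.
move=> s0 st tT; apply/lee_addgt0Pr => e e0.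
have K0 : 0 <= K by rewrite (le_trans (A0 0)).
have K1 : 0 < K + 1 by rewrite ltr_wpDl.
have e2 : 0 < e / 2 by rewrite divr_gt0.
have d0 : 0 < (e / 2) ^+ 2 / (K + 1) by rewrite divr_gt0// exprn_gt0.
have [n fnt] : exists n, f n t < e / 2.
  have [|r] := @rat_in_itvoo R t (t + (e / 2) ^+ 2 / (K + 1)); first by rewrite ltrDl.
  rewrite in_itv/= => /andP[tr rt]; exists (pickle r).
  rewrite /f /ratn pickleK/=; apply: w_modulus => //.
  rewrite distrC gtr0_norm ?subr_gt0//.
  have : ratr r - t < (e / 2) ^+ 2 / (K + 1) by rewrite ltrBlDl.
  rewrite ltr_pdivlMr//; apply: le_lt_trans; rewrite ler_wpM2l ?subr_ge0 ?lerDl//.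
  exact: ltW.
apply: (@le_trans _ _ (\int[mu]_(x in `[s, t]) `|(k n x)%:E| + e%:E)%E).
  apply: (@le_trans _ _ (`|(f n t - f n s)%:E| + e%:E)%E).
    rewrite abse_EFin -EFinD lee_fin.
    have wf : mdist (w s) (w t) <= f n s + f n t.
      by rewrite /f [X in X + _]metric_sym; exact: metric_triangle.
    have := ler_norm (f n s - f n t); rewrite distrC; lra.
  rewrite leeD2r// -kE//; apply: le_abse_integral => //.
  by apply/measurable_EFinP; exact: measurable_funS (mk n).
rewrite leeD2r//.
have mkn (D : set R) : measurable_fun D (fun x => `|(k n x)%:E|%E).
  by apply: measurableT_comp => //; apply/measurable_EFinP; exact: measurable_funS (mk n).
have mND (D : set R) : measurable_fun D (fun x => (N x)%:E).
  by apply/measurable_EFinP; exact: measurable_funS mN.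
rewrite (integral_itv_bndoo _ _ (mkn _)) [leRHS](integral_itv_bndoo _ _ (mND _)).
apply: ae_ge0_le_integral => //.
- exact: mkn.
- by move=> x _; rewrite lee_fin.
- exact: mND.
- apply: (lebesgue_aeS _ NeN) => x H; rewrite /= in_itv/= => /andP[sx xt].
  have [|<- _] := H _; first by rewrite (le_lt_trans s0)//= (lt_le_trans xt).
  by apply: ereal_sup_ubound; exists n.
Qed.

Let G y := (\int[mu]_(x in `[0%R, y]) N x)%R.

Let dist_G s t : 0 <= s <= T -> 0 <= t <= T -> mdist (w s) (w t) <= `|G s - G t|.
Proof.
wlog st : s t / s <= t => [H|] sT tT.
  have [st|/ltW ts] := leP s t; first exact: H.
  by rewrite distrC metric_sym; exact: H.
move: sT tT => /andP[s0 sT] /andP[t0 tT].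
rewrite distrC -lee_fin; apply: le_trans (dist_le s0 st tT) _.
have Ni (x y : R) : mu.-integrable `[x, y] (EFin \o N) by exact: integrableS N_int.
have Ni' (x y : R) : mu.-integrable `]x, y] (EFin \o N) by exact: integrableS N_int.
rewrite /G Rintegral_itvB//.
rewrite Rintegral_itv_obnd_cbnd// -[leLHS]fineK ?integrable_fin_num//.
by rewrite lee_fin ler_norm.
Qed.

(** From above, the distance is at most the increment of the primitive [G] of [N], differentiated at
    a Lebesgue point. From below, it is at least the increment of any [f n]; an [n] with [|k n t|]
    close to the supremum is used. *)
Let N_derivative : {ae mu, forall t, 0 < t < T -> metric_derivative w t = N t}.
Proof.
have Npt : {ae mu, forall t, lebesgue_pt N t}.
  by apply: lebesgue_differentiation; apply: open_integrable_locally => //; exact: openT.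
apply: (lebesgue_aeS2 _ k_derive).
  2: by apply: (lebesgue_aeS2 _ Npt NeN) => t; exact: conj.
move=> t /= Hk [Nt Ht] tT; have {}Hk := Hk tT; have {Ht} [NeE _] := Ht tT.
move/andP: (tT) => [t0 tT'].
have [dG G't] : derivable G t 1 /\ derive1 G t = N t.
  apply: (@FTC1_lebesgue_pt _ N (BLeft 0) t T) => //.
  exact: integrableS N_int.
apply/cvg_lim => //; apply/cvgrPdist_lt => e e0.
have e2 : 0 < e / 2 by rewrite divr_gt0.
have [d1 d10 H1] := derivable_quotient dG e0.
have [n Hn] : exists n, N t - e / 2 < `|k n t|.
  have Nef : Ne t \is a fin_num by rewrite NeE.
  have [_ [n _ <-]] := ub_ereal_sup_adherent e2 Nef.
  by rewrite -/(Ne t) NeE -EFinB abse_EFin lte_fin => H; exists n.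
have [d2 d20 H2] := Hk n _ e2.
have m0 : 0 < Num.min (Num.min d1 d2) (Num.min t (T - t)).
  by rewrite !lt_min d10 d20 t0 subr_gt0.
exists (Num.min (Num.min d1 d2) (Num.min t (T - t))) => //= s.
rewrite /ball_/= distrC !lt_min => /andP[/andP[sd1 sd2] /andP[st1 st2]] st.
have sT : 0 <= s <= T.
  by move: st1 st2; rewrite !ltr_norml => /andP[? ?] /andP[? ?]; apply/andP; split; lra.
have stp : 0 < `|s - t| by rewrite normr_gt0 subr_eq0.
have U : mdist (w s) (w t) / `|s - t| < N t + e.
  apply: (@le_lt_trans _ _ (`|(G s - G t) / (s - t)|)).
    by rewrite normrM normfV ler_pM2r ?invr_gt0// dist_G// !ltW.
  by have := H1 s st sd1; rewrite G't ltr_norml ltr_norml => /andP[? ?]; apply/andP; split; have := N_ge0 t; lra.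
have V : N t - e < mdist (w s) (w t) / `|s - t|.
  apply: (@lt_le_trans _ _ (`|(f n s - f n t) / (s - t)|)); last first.
    by rewrite normrM normfV ler_pM2r ?invr_gt0// metric_sym f_lip.
  have := H2 s st sd2; have := lerB_dist (k n t) ((f n s - f n t) / (s - t)).
  rewrite distrC; lra.
by rewrite ltr_norml; apply/andP; split; lra.
Qed.

Theorem metric_speed : exists N : R -> R,
  [/\ measurable_fun [set: R] N, forall t, 0 <= N t,
      forall b, 0 <= b -> b <= T ->
        (\int[mu]_(t in `[0%R, b]) (N t ^+ 2)%:E <= (A b)%:E)%E,
      forall s t, 0 <= s -> s <= t -> t <= T ->
        ((mdist (w s) (w t))%:E <= \int[mu]_(x in `[s, t]) (N x)%:E)%E &
      {ae mu, forall t, 0 < t < T -> metric_derivative w t = N t}].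
Proof. by exists N; split. Qed.

End metric_speed.

(** * Slope and proximal step *)

Section metric.
Context {R : realType} {X : metricType R}.

Lemma cvg_mdist T (F : set_system T) (x y : T -> X) (p q : X) : Filter F ->
  x @ F --> p -> y @ F --> q -> mdist (x n) (y n) @[n --> F] --> mdist p q.
Proof.
move=> FF xp yq; apply/cvgrPdist_lt => e e0.
have e2 : 0 < e / 2 by rewrite divr_gt0.
have Hx : \forall n \near F, mdist p (x n) < e / 2.
  by have := xp _ (nbhsx_ballx p _ e2); rewrite ballEmdist.
have Hy : \forall n \near F, mdist q (y n) < e / 2.
  by have := yq _ (nbhsx_ballx q _ e2); rewrite ballEmdist.
apply: filterS2 Hx Hy => n h5 h6.
have := metric_triangle p (x n) q; have := metric_triangle (x n) (y n) q.
have := metric_triangle (x n) p (y n); have := metric_triangle p q (y n).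
rewrite [mdist (x n) p]metric_sym [mdist (y n) q]metric_sym.
by move=> h1 h2 h3 h4; rewrite ltr_norml; apply/andP; split; lra.
Qed.

Lemma ultra_compact_cvg T (U : set_system T) (K : set X) (x : T -> X) :
  UltraFilter U -> compact K -> (\forall n \near U, K (x n)) ->
  exists2 p, K p & x @ U --> p.
Proof.
move=> UU; rewrite compact_ultra => cK Kx.
by have [p [Kp xp]] := cK _ (fmap_ultra x UU) Kx; exists p.
Qed.

End metric.

Lemma le_real_approx (R : realType) (x : \bar R) (y : R) :
  (forall a : R, (a%:E < x)%E -> a <= y) -> (x <= y%:E)%E.
Proof.
case: x => [r| |] H; last by rewrite leNye.
  rewrite lee_fin leNgt; apply/negP => yr.
  by have := H ((y + r) / 2); rewrite lte_fin => /(_ (midf_lt yr).2); rewrite leNgt (midf_lt yr).1.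
by have := H (y + 1) (ltry _); rewrite gerDl leNgt ltr01.
Qed.

Section slope.
Context {R : realType} {X : metricType R}.
Implicit Types (phi : X -> \bar R) (u v x y : X).
Local Open Scope ereal_scope.

Lemma local_slope_ge0 phi u : 0 <= local_slope phi u.
Proof. by rewrite /local_slope; case: ifP => // _; rewrite le_max lexx. Qed.

Lemma local_slope_le phi u (c : R) : (0 <= c)%R -> phi u < +oo ->
  (forall e : R, (0 < e)%R -> \forall w \near u^',
    maxe (phi u - phi w) 0 * ((mdist u w)^-1)%:E <= (c + e)%:E) ->
  local_slope phi u <= c%:E.
Proof.
move=> c0 pu H; rewrite /local_slope pu ge_max lee_fin c0/=.
apply/lee_addgt0Pr => e e0; rewrite limf_esupE -EFinD.
pose f w := maxe (phi u - phi w) 0 * ((mdist u w)^-1)%:E.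
pose V := [set w | f w <= (c + e)%:E].
apply: (@le_trans _ _ (ereal_sup (f @` V))).
  by apply: ereal_inf_lbound; exists V => //; exact: H.
by apply: ge_ereal_sup => _ [w Hw <-].
Qed.

Definition geodesically_convex0 phi := forall x y, phi x < +oo -> phi y < +oo ->
  exists gamma : R -> X, [/\ constant_speed_geodesic gamma,
    gamma 0%R = x, gamma 1%R = y &
    forall t : R, t \in `[0%R, 1%R] ->
      phi (gamma t) <= (1 - t)%:E * phi x + t%:E * phi y].

(* Testing the convexity of the penalized functional centred at the starting
   point x, the quadratic terms cancel exactly. *)
Lemma penalized_convex_geodesically_convex0 phi (tau : R) : (0 < tau)%R ->
  (forall v, 0 <= phi v) ->
  (forall v, geodesically_convex tau^-1
    (fun u => (mdist u v ^+ 2 / (2 * tau))%:E + phi u)) ->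
  geodesically_convex0 phi.
Proof.
move=> tau0 phi0 cvx x y px py.
have [||g [gg g0 g1 H]] := cvx x x y.
- by rewrite lte_add_pinfty// ltry.
- by rewrite lte_add_pinfty// ltry.
exists g; split => // t t01; have {}H := H t t01; have [_ gd] := gg.
move: H.
have t0 : (0%R : R) \in `[0%R, 1%R] by rewrite in_itv/= lexx ler01.
move: (t01); rewrite in_itv/= => /andP[t0' t1'].
have -> : mdist (g t) x = (mdist x y * t)%R.
  by have := gd 0%R t t0 t01; rewrite g0 g1 subr0 ger0_norm.
have pxf : phi x \is a fin_num by rewrite ge0_fin_numE.
have pyf : phi y \is a fin_num by rewrite ge0_fin_numE.
rewrite mdistxx expr0n/= mul0r add0e [mdist y x]metric_sym.
move: pxf pyf (phi0 (g t)) {px py}; case: (phi x) => // p _; case: (phi y) => // r _.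
case: (phi (g t)) => //= z _.
rewrite -!EFinD !lee_fin => H.
suff E : ((1 - t) * p + t * (mdist x y ^+ 2 / (2 * tau) + r) -
  tau^-1 / 2 * t * (1 - t) * mdist x y ^+ 2 = (1 - t) * p + t * r + (mdist x y * t) ^+ 2 / (2 * tau))%R.
  by move: H; rewrite E; lra.
by field; rewrite gt_eqF.
Qed.

(** Along the geodesic [g] from x to y, convexity gives phi(x) - phi(g r) >= r (phi(x) - phi(y)),
    while d(x, g r) = r d(x, y). The quotient at [g r] is thus at least (phi(x) - phi(y)) / d(x, y)
    for every r in ]0, 1], and [g r] enters each punctured neighbourhood of x. *)
Lemma local_slope_global phi x y : (forall v, 0 <= phi v) ->
  geodesically_convex0 phi -> phi x < +oo -> phi y < +oo ->
  phi x <= phi y + local_slope phi x * (mdist x y)%:E.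
Proof.
move=> phi0 cvx px py; have [->|xy] := eqVneq x y.
  by rewrite mdistxx mule0 adde0.
have [yx|xly] := leP (phi x) (phi y).
  by rewrite (le_trans yx)// leeDl// mule_ge0 ?local_slope_ge0// lee_fin mdist_ge0.
have [g [[_ gd] g0 g1 gH]] := cvx x y px py.
have d0 : (0 < mdist x y)%R by rewrite mdist_gt0.
rewrite -leeBlDl ?ge0_fin_numE// -lee_pdivrMr//.
rewrite /local_slope px le_max; apply/orP; right.
rewrite limf_esupE; apply: le_ereal_inf_tmp => _ [V Vx <-].
have [e /= e0 eV] : exists2 e : R, (0 < e)%R & forall w, (mdist x w < e)%R -> w != x -> V w.
  move: Vx => /nbhs_ballP[e /= e0 H]; exists e => // w xw wx.
  by apply: H => //; rewrite ballEmdist.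
pose r : R := Num.min 1%R (e / (2 * mdist x y))%R.
have r0 : (0 < r)%R by rewrite lt_min ltr01 divr_gt0// mulr_gt0.
have r1 : (r <= 1)%R by rewrite ge_min lexx.
have r01 : r \in `[0%R, 1%R] by rewrite in_itv/= (ltW r0) r1.
have t0 : (0%R : R) \in `[0%R, 1%R] by rewrite in_itv/= lexx ler01.
have dr : mdist x (g r) = (r * mdist x y)%R.
  by have := gd r 0%R r01 t0; rewrite g0 g1 sub0r normrN gtr0_norm// metric_sym mulrC.
have dre : (r * mdist x y < e)%R.
  have : (r * mdist x y <= e / 2)%R.
    by rewrite -ler_pdivlMr// ge_min -mulrA -invfM lexx orbT.
  by move/le_lt_trans; apply; rewrite ltr_pdivrMr// ltr_pMr// ltr1n.
apply: le_trans (_ : _ <= maxe (phi x - phi (g r)) 0 * ((mdist x (g r))^-1)%:E) _; last first.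
  apply: ereal_sup_ubound; exists (g r) => //; apply: eV; rewrite ?dr//.
  by rewrite eq_sym -mdist_gt0 dr mulr_gt0.
have := gH r r01; rewrite dr invfM mulrC EFinM muleA.
have pxf : phi x \is a fin_num by rewrite ge0_fin_numE.
have pyf : phi y \is a fin_num by rewrite ge0_fin_numE.
move: (phi0 (g r)) pxf pyf; case: (phi x) => // p; case: (phi y) => // q; case: (phi (g r)) => // z _ _ _.
rewrite -!EFinM -!EFinD -EFin_max -!EFinM !lee_fin => H.
rewrite [leRHS]mulrAC ler_pM2r ?invr_gt0// ler_pdivlMr// le_max; apply/orP; left; lra.
Qed.

End slope.

Section proximal.
Context {R : realType} {X : metricType R}.
Variables (phi : X -> \bar R) (v : X) (tau : R).
Hypotheses (phi0 : forall v, (0 <= phi v)%E) (phi_lsc : lower_semicontinuous phi)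
  (phi_compact : forall c : R, compact [set v | (phi v <= c%:E)%E])
  (tau0 : 0 < tau) (pv : (phi v < +oo)%E).
Local Open Scope ereal_scope.

Let Phi u : \bar R := (mdist u v ^+ 2 / (2 * tau))%:E + phi u.

Let Phi0 u : 0 <= Phi u.
Proof. by rewrite adde_ge0// lee_fin divr_ge0 ?sqr_ge0// mulr_ge0// ltW. Qed.

(** Direct method: a minimizing sequence stays in a compact sublevel of [phi], hence converges along
    an ultrafilter; the distance term is continuous and [phi] lower semicontinuous. *)
Lemma proximal_minimizer : exists u, forall w, Phi u <= Phi w.
Proof.
pose m := ereal_inf (range Phi).
have m0 : 0 <= m by apply: le_ereal_inf_tmp => _ [w _ <-].
have mv : m <= Phi v by apply: ereal_inf_lbound; exists v.
have Phiv : Phi v = phi v by rewrite /Phi mdistxx expr0n/= mul0r add0e.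
have mf : m \is a fin_num by rewrite ge0_fin_numE// (le_lt_trans mv)// Phiv.
have approx (n : nat) : exists w, Phi w < m + (n.+1%:R^-1)%:E.
  have n0 : (0 < n.+1%:R^-1 :> R)%R by rewrite invr_gt0.
  by have [_ [w _ <-]] := lb_ereal_inf_adherent n0 mf; exists w.
pose x n := sval (cid (approx n)).
have xP n : Phi (x n) < m + (n.+1%:R^-1)%:E by exact: svalP (cid (approx n)).
have [U [UU ooU]] := ultraFilterLemma (eventually_filter : ProperFilter \oo).
have xK n : phi (x n) <= (fine m + 1)%:E.
  apply: (@le_trans _ _ (Phi (x n))).
    by rewrite leeDr// lee_fin divr_ge0 ?sqr_ge0// mulr_ge0// ltW.
  rewrite (le_trans (ltW (xP n)))// EFinD fineK// leeD2l// lee_fin.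
  by rewrite invf_le1// ler1n.
have [u _ xu] := ultra_compact_cvg UU (@phi_compact _) (filterE _ xK).
exists u => w; apply: (@le_trans _ _ m); last by apply: ereal_inf_lbound; exists w.
rewrite /Phi -leeBrDl// -[m]fineK// -EFinB; apply: le_real_approx => a au.
have [V Vu Va] := phi_lsc au.
have dl : (mdist (x n) v ^+ 2 / (2 * tau))%R @[n --> U] --> (mdist u v ^+ 2 / (2 * tau))%R.
  by apply: cvgMl; rewrite expr2; apply: cvgM; (apply: cvg_mdist => //; exact: cvg_cst).
have nl : (fine m + n.+1%:R^-1)%R @[n --> U] --> fine m.
  rewrite -[X in _ --> X]addr0; apply: cvgD; first exact: cvg_cst.
  by move=> B /(@cvg_harmonic R); exact: ooU.
rewrite lerBrDr; apply: (ler_cvg_to _ nl (f := fun n => (a + mdist (x n) v ^+ 2 / (2 * tau))%R)).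
  by apply: cvgD => //; exact: cvg_cst.
have : \forall n \near U, V (x n) by exact: xu.
apply: filterS => n /Va an; rewrite -lee_fin.
rewrite addrC EFinD [leRHS]EFinD fineK//.
apply: le_trans (ltW (xP n)); rewrite /Phi leeD2l//; exact: ltW.
Qed.

Lemma proximal_slope u : (forall w, Phi u <= Phi w) ->
  local_slope phi u <= (mdist u v / tau)%:E.
Proof.
move=> Hmin.
have Phiv : Phi v = phi v by rewrite /Phi mdistxx expr0n/= mul0r add0e.
have pu : phi u < +oo.
  have := Hmin v; rewrite Phiv => /le_lt_trans/(_ pv).
  by apply: le_lt_trans; rewrite /Phi leeDr// lee_fin divr_ge0 ?sqr_ge0// mulr_ge0// ltW.
have puf : phi u \is a fin_num by rewrite ge0_fin_numE.
apply: local_slope_le => //; first by rewrite divr_ge0 ?mdist_ge0// ltW.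
(* By minimality and the triangle inequality, the quotient exceeds d(u, v) / tau by at most d(u, w)
   / (2 tau), which is below [e] in this ball. *)
move=> e e0; apply/nbhs_ballP; exists (2 * tau * e)%R => /=; first by rewrite !mulr_gt0.
move=> w; rewrite ballEmdist/= => uw wu.
have d0 : (0 < mdist u w)%R by rewrite mdist_gt0 eq_sym.
rewrite lee_pdivrMr// -EFinM ge_max; apply/andP; split; last first.
  by rewrite lee_fin mulr_ge0 ?mdist_ge0// addr_ge0 ?(ltW e0)// divr_ge0 ?mdist_ge0// ltW.
have := Hmin w; rewrite /Phi; move: puf (phi0 w).
case: (phi u) => // p _; case: (phi w) => [q _|_ _|//]; last by rewrite addeNy leNye.
rewrite -!EFinD !lee_fin => H.
have dw : (mdist w v <= mdist u w + mdist u v)%R.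
  by rewrite [mdist u w]metric_sym metric_triangle.
have dsq : (mdist w v ^+ 2 <= (mdist u w + mdist u v) ^+ 2)%R.
  by rewrite ler_sqr ?nnegrE ?addr_ge0 ?mdist_ge0.
have : (p - q <= ((mdist u w + mdist u v) ^+ 2 - mdist u v ^+ 2) / (2 * tau))%R.
  rewrite mulrBl lerBlDr; apply: le_trans (_ : _ <= mdist w v ^+ 2 / (2 * tau) + q - mdist u v ^+ 2 / (2 * tau))%R _.
    by rewrite lerBrDl.
  by rewrite addrAC lerD2r lerD2r ler_pM2r// invr_gt0 mulr_gt0.
move/le_trans; apply.
rewrite ler_pdivrMr ?mulr_gt0//.
have -> : ((mdist u v / tau + e) * mdist u w * (2 * tau) =
   2 * mdist u v * mdist u w + (2 * tau * e) * mdist u w)%R by field; rewrite gt_eqF.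
by nra.
Qed.

End proximal.

Lemma proximal_step (R : realType) (X : metricType R) (phi : X -> \bar R)
    (v : X) (tau : R) : (forall v, (0 <= phi v)%E) ->
  lower_semicontinuous phi ->
  (forall c : R, compact [set v | (phi v <= c%:E)%E]) -> 0 < tau ->
  geodesically_convex tau^-1 (fun u => ((mdist u v ^+ 2 / (2 * tau))%:E + phi u)%E) ->
  dom_slope phi v -> local_slope phi v <> 0%E ->
  exists u, [/\ dom_slope phi u, u <> v & (Ghat phi tau u v <= 0)%E].
Proof.
move=> phi0 phi_lsc phi_compact tau0 cvx [pv sv] sv0.
have [u umin] := proximal_minimizer phi0 phi_lsc phi_compact tau0 pv.
have su := proximal_slope phi0 tau0 pv umin.
have pvf : phi v \is a fin_num by rewrite ge0_fin_numE.
have puv : ((mdist u v ^+ 2 / (2 * tau))%:E + phi u <= phi v)%E.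
  by rewrite (le_trans (umin v))// mdistxx expr0n/= mul0r add0e.
have puf : phi u \is a fin_num.
  rewrite ge0_fin_numE// (le_lt_trans _ pv)// (le_trans _ puv)// leeDr// lee_fin.
  by rewrite divr_ge0 ?sqr_ge0// mulr_ge0// ltW.
have suf : local_slope phi u \is a fin_num.
  by rewrite ge0_fin_numE ?local_slope_ge0// (le_lt_trans su)// ltry.
exists u; split.
- by split; rewrite /edom/= -ge0_fin_numE ?local_slope_ge0.
- move=> uv; apply: sv0; apply/eqP; rewrite eq_le local_slope_ge0 andbT.
  by move: su; rewrite uv mdistxx mul0r.
have [||g [gg g0 g1 H]] := cvx u v.
- by rewrite (le_lt_trans puv).
- by rewrite mdistxx expr0n/= mul0r add0e.
pose d := mdist u v ^+ 2 / (2 * tau).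
have d0 : 0 <= d by rewrite divr_ge0 ?sqr_ge0// mulr_ge0// ltW.
(* Comparing [u] with the point [g t] and dividing by [t] gives phi(u) + d + (1 - t) d <= phi(v);
   then [t] tends to 0. *)
have key : fine (phi u) + d + d <= fine (phi v).
  apply/ler_addgt0Pr => e e0; pose t := Num.min 1 (e / (d + 1)).
  have t0 : 0 < t by rewrite lt_min ltr01 divr_gt0// ltr_wpDl.
  have t1 : t <= 1 by rewrite ge_min lexx.
  have td : t * d <= e.
    apply: (@le_trans _ _ (e / (d + 1) * d)).
      by rewrite ler_wpM2r// ge_min lexx orbT.
    by rewrite -mulrA ger_pMr// mulrC ler_pdivrMr ?ltr_wpDl// mul1r lerDl.
  have tI : t \in `[0, 1] by rewrite in_itv/= ltW.
  have := le_trans (umin (g t)) (H t tI).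
  rewrite -(fineK puf) -(fineK pvf) mdistxx expr0n/= mul0r add0e.
  rewrite -!EFinD !lee_fin -/d => {}H.
  have E : tau^-1 / 2 * t * (1 - t) * mdist u v ^+ 2 = t * ((1 - t) * d).
    by rewrite /d; field; rewrite gt_eqF.
  move: H; rewrite E => H.
  have : t * (d + fine (phi u)) <= t * (fine (phi v) - (1 - t) * d) by lra.
  by rewrite ler_pM2l//; lra.
(* One [d] in [key] is the distance term of [Ghat]; the other pays for the slope term, since (tau /
   2) (d(u, v) / tau)^2 = d. *)
rewrite /Ghat -(fineK puf) -(fineK pvf) -(fineK suf) -EFin_expe -!EFinM -!EFinD lee_fin.
move: su; rewrite -(fineK suf) lee_fin => su.
have s0 : 0 <= fine (local_slope phi u) by rewrite fine_ge0// local_slope_ge0.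
have : fine (local_slope phi u) ^+ 2 <= (mdist u v / tau) ^+ 2.
  by rewrite ler_sqr ?nnegrE// (le_trans s0).
have t2 : 0 <= tau / 2 by rewrite divr_ge0// ltW.
move=> /(ler_wpM2l t2) /=.
have -> : tau / 2 * (mdist u v / tau) ^+ 2 = d by rewrite /d; field; rewrite gt_eqF.
move: key; rewrite -/d; lra.
Qed.

(** * Upper energy bound for convex functionals *)

Section ae_eq_nonmeasurable.
Context d (T : measurableType d) (R : realType).
Variable mu : {measure set T -> \bar R}.
Local Open Scope ereal_scope.
Import HBNNSimple.

(* The metric derivative agrees with a measurable function almost everywhere
   but need not be measurable, as the completion of the Borel sets is not used. *)
Lemma ge0_ae_eq_integral_nonmeasurable (D : set T) (f g : T -> \bar R) :
  measurable D -> measurable_fun D g ->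
  (forall x, D x -> 0 <= f x) -> (forall x, D x -> 0 <= g x) ->
  ae_eq mu D f g -> \int[mu]_(x in D) f x = \int[mu]_(x in D) g x.
Proof.
move=> mD mg f0 g0 [Z [mZ Z0 fgZ]].
have fg x : D x -> ~ Z x -> f x = g x.
  by move=> Dx Zx; apply: contrapT => H; apply: Zx; apply: fgZ => /= /(_ Dx).
apply/eqP; rewrite eq_le; apply/andP; split.
- rewrite ge0_integralE//; apply: ge_ereal_sup => _ [h /= hf <-].
  rewrite -integralT_nnsfun.
  have mh : measurable_fun [set: T] (EFin \o h) by exact/measurable_EFinP.
  have h0 x : [set: T] x -> 0 <= (EFin \o h) x by rewrite lee_fin.
  rewrite (ge0_negligible_integral mZ measurableT mh h0 Z0).
  rewrite [leRHS]integral_mkcond.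
  apply: (@le_trans _ _ (\int[mu]_(x in [set: T] `\` Z) (g \_ D) x)).
    apply: ge0_le_integral => //.
    + exact: measurableD.
    + by move=> x _; exact: h0.
    + exact: measurable_funS mh.
    + by apply: measurable_funTS; exact/(measurable_restrictT _ _).1.
    + move=> x [_ Zx]; apply: le_trans (hf x) _; rewrite !patchE.
      by case: ifPn => //; rewrite inE => Dx; rewrite fg.
  apply: ge0_subset_integral => //.
  + exact: measurableD.
  + exact/(measurable_restrictT _ _).1.
  + by move=> x _; rewrite patchE; case: ifPn => //; rewrite inE => /g0.
- rewrite (ge0_negligible_integral mZ mD mg g0 Z0).
  rewrite (eq_integral f); last first.
    by move=> x; rewrite inE => -[Dx Zx]; rewrite fg.
  rewrite !ge0_integralE//; last by move=> x [/f0].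
  apply: le_ereal_sup => _ [h /= hf <-]; exists h => //= x.
  apply: le_trans (hf x) _; rewrite !patchE.
  case: ifPn => [|_]; last by case: ifPn => //; rewrite inE => /f0.
  by rewrite inE => -[Dx _]; rewrite mem_set.
Qed.

End ae_eq_nonmeasurable.

Section energy.
Context {R : realType} {X : metricType R}.
Notation mu := (@lebesgue_measure R).
Variables (phi : X -> \bar R) (w : R -> X) (B : R -> R) (b M : R).
Hypotheses (phi0 : forall v, (0 <= phi v)%E) (phi_lsc : lower_semicontinuous phi)
  (slope_lsc : lower_semicontinuous (local_slope phi))
  (phi_cvx : geodesically_convex0 phi)
  (w_cont : continuous w) (b0 : 0 <= b)
  (wM : forall t, 0 <= t <= b -> (phi (w t) <= M%:E)%E)
  (B0 : forall t, 0 <= B t) (ndB : {homo B : x y / x <= y})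
  (wB : forall s t, 0 <= s -> s <= t -> t <= b ->
     mdist (w s) (w t) ^+ 2 <= (t - s) * (B t - B s)).
Local Open Scope ereal_scope.

Lemma lower_semicontinuous_comp (Y : topologicalType) (psi : X -> \bar R) (v : Y -> X) :
  lower_semicontinuous psi -> continuous v -> lower_semicontinuous (psi \o v).
Proof.
move=> lpsi cv x a /lpsi[V Vx Va]; exists (v @^-1` V) => [|y]; first exact: cv.
exact: Va.
Qed.

(** Freezing time at [b] keeps shifted times in [0, b] and makes the integral of [F] over [b, b + h]
    exactly [h * phi (w b)]. *)
Let m s : R := Num.min s b.
Let m_cont : continuous m.
Proof. by move=> s; apply: continuous_min => //; exact: cvg_cst. Qed.
Let F s := phi (w (m s)).
Let mF : measurable_fun [set: R] F.
Proof.
apply: lower_semicontinuous_measurable.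
apply: (@lower_semicontinuous_comp _ phi (w \o m)) => // s.
by apply: continuous_comp; [exact: m_cont|exact: w_cont].
Qed.
Let F0 s : 0 <= F s. Proof. exact: phi0. Qed.
Let g s := local_slope phi (w s).
Let mg : measurable_fun [set: R] g.
Proof.
apply: lower_semicontinuous_measurable.
exact: (@lower_semicontinuous_comp _ (local_slope phi) w).
Qed.
Let g0 s : 0 <= g s. Proof. exact: local_slope_ge0. Qed.
Let Bm s := B (m s).
Let ndBm : {homo Bm : x y / (x <= y)%R}.
Proof. by move=> x y xy; apply: ndB; rewrite /m le_min !ge_min xy lexx orbT. Qed.

(** The global slope inequality followed by Young's inequality g d <= (h / 2) g^2 + d^2 / (2 h),
    where d^2 / h is at most the increment of [Bm]. *)
Let step_le (h s : R) : (0 < h)%R -> (0 <= s <= b)%R ->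
  F s <= F (s + h)%R + ((h / 2)%:E * g s ^+ 2 + (2^-1)%:E * (Bm (s + h) - Bm s)%:E).
Proof.
move=> h0 /andP[s0 sb].
have ms : m s = s by rewrite /m; apply/min_idPl.
have s0' : (0 <= m (s + h))%R by rewrite /m le_min b0 addr_ge0// ltW.
have smh : (s <= m (s + h))%R by rewrite /m le_min sb lerDl ltW.
have mhb : (m (s + h) <= b)%R by rewrite /m ge_min lexx orbT.
have mhh : (m (s + h) - s <= h)%R by rewrite lerBlDl /m ge_min lexx.
have := @local_slope_global R X phi (w s) (w (m (s + h)%R)) phi0 phi_cvx.
rewrite (le_lt_trans (@wM s _)) ?ltry ?s0// (le_lt_trans (@wM (m (s + h)%R) _)) ?ltry ?s0'// => /(_ isT isT).
rewrite /F ms => /le_trans; apply; rewrite leeD2l// -/(g s).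
set d := mdist _ _.
have dB : (d ^+ 2 <= h * (Bm (s + h) - Bm s))%R.
  apply: le_trans (wB s0 smh mhb) _; rewrite /Bm ms ler_wpM2r// subr_ge0 ndB//.
have BB : (0 <= Bm (s + h) - Bm s)%R by rewrite subr_ge0 ndBm// lerDl ltW.
have d0 : (0 <= d)%R by exact: mdist_ge0.
move: (g0 s); case: (g s) => [r|_|//]; last first.
  by rewrite expe2 mulyy gt0_muley ?lte_fin ?divr_gt0// addye// leey.
rewrite -EFin_expe -!EFinM -!EFinD !lee_fin => r0.
have : (0 <= (h * r - d) ^+ 2)%R by rewrite sqr_ge0.
have -> : ((h * r - d) ^+ 2 = h * (h * r ^+ 2 - 2 * (r * d)) + d ^+ 2)%R by ring.
move=> H; have : (0 <= h * (h * r ^+ 2 - 2 * (r * d) + (Bm (s + h) - Bm s)))%R.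
  by rewrite mulrDr; apply: le_trans H _; rewrite lerD2l.
by rewrite pmulr_rge0//; lra.
Qed.

(* Integrating [step_le] over [0, b], all but the pieces of length h at both
   ends of the integrals of F cancel. *)
Let average_le (h : R) : (0 < h)%R ->
  \int[mu]_(s in `[0%R, h]) F s <=
  h%:E * (phi (w b) + (2^-1)%:E * \int[mu]_(s in `[0%R, b]) g s ^+ 2 + (2^-1 * B b)%:E).
Proof.
move=> h0.
have mFh : measurable_fun [set: R] (fun s => F (s + h)%R).
  by apply: (measurableT_comp mF); exact: measurable_shift.
have mBm : measurable_fun [set: R] Bm by exact: nondecreasing_measurable.
have mBmh : measurable_fun [set: R] (fun s => Bm (s + h)%R).
  by apply: nondecreasing_measurable => // x y xy; apply: ndBm; rewrite lerD2r.
have mg2 (D : set R) : measurable_fun D (fun s => g s ^+ 2).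
  under eq_fun do rewrite expe2.
  by apply: emeasurable_funM; exact: measurable_funS mg.
have mg2h (D : set R) : measurable_fun D (fun s => (h / 2)%:E * g s ^+ 2).
  by apply: measurable_funeM; exact: mg2.
have mBd (D : set R) : measurable_fun D (fun s => (Bm (s + h) - Bm s)%:E).
  by apply/measurable_EFinP; apply: measurable_funB; exact: measurable_funS measurableT _ _.
have mBd2 (D : set R) : measurable_fun D (fun s => (2^-1)%:E * (Bm (s + h) - Bm s)%:E).
  by apply: measurable_funeM; exact: mBd.
have BB s : (0 <= Bm (s + h) - Bm s)%R by rewrite subr_ge0 ndBm// lerDl ltW.
(* Finiteness permits this integral to be cancelled from both sides at the end. *)
have I_fin : \int[mu]_(s in `[0%R, b]) F s \is a fin_num.
  rewrite ge0_fin_numE; last exact: integral_ge0.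
  apply: (@le_lt_trans _ _ (\int[mu]_(s in `[0%R, b]) (cst (M%:E) s))).
    apply: ge0_le_integral => //.
    - exact: measurable_funS mF.
    - move=> s; rewrite /= in_itv/= => /andP[s0 sb]; rewrite /F /m (min_idPl sb).
      by apply: wM; rewrite s0.
  rewrite integral_cst//= lebesgue_measure_itv/= lte_fin.
  by case: ifP => _; rewrite ?mule0 ?ltry// -EFinB -EFinM ltry.
have h2 : (0 <= h / 2)%R by rewrite divr_ge0// ltW.
have le1 : \int[mu]_(s in `[0%R, b]) F s <= \int[mu]_(s in `[0%R, b]) F (s + h)%R +
    ((h / 2)%:E * \int[mu]_(s in `[0%R, b]) g s ^+ 2 + (2^-1 * (h * B b))%:E).
  apply: (@le_trans _ _ (\int[mu]_(s in `[0%R, b]) (F (s + h)%R +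
      ((h / 2)%:E * g s ^+ 2 + (2^-1)%:E * (Bm (s + h) - Bm s)%:E)))).
    apply: ge0_le_integral => //.
    - exact: measurable_funS mF.
    - apply: emeasurable_funD; first exact: measurable_funS mFh.
      by apply: emeasurable_funD; [exact: mg2h|exact: mBd2].
    - by move=> s; rewrite /= in_itv/=; exact: step_le.
  rewrite ge0_integralD//; last 3 first.
  - exact: measurable_funS mFh.
  - by move=> s _; rewrite adde_ge0// mule_ge0// ?lee_fin// expe_ge0.
  - by apply: emeasurable_funD; [exact: mg2h|exact: mBd2].
  rewrite leeD2l// ge0_integralD//; last 4 first.
  - by move=> s _; rewrite mule_ge0// expe_ge0.
  - exact: mg2h.
  - by move=> s _; rewrite lee_fin mulr_ge0.
  - exact: mBd2.
  rewrite ge0_integralZl//; last 2 first.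
  - exact: mg2.
  - by move=> s _; exact: expe_ge0.
  rewrite leeD2l// ge0_integralZl//; last 2 first.
  - exact: mBd.
  - by move=> s _; rewrite lee_fin.
  rewrite EFinM lee_wpmul2l//.
  have Bm0 s : (0 <= Bm s)%R by exact: B0.
  apply: le_trans (nd_integral_shift b0 (ltW h0) ndBm Bm0) _.
  by rewrite lee_fin ler_wpM2l ?(ltW h0)// ndB// /m ge_min lexx orbT.
have E := ge0_integral_shift_split (ltW h0) b0 mF F0; rewrite add0r in E.
have Fb : \int[mu]_(s in `[b, (b + h)%R]) F s = h%:E * phi (w b).
  rewrite (eq_integral (cst (phi (w b)))); last first.
    move=> s; rewrite inE/= in_itv/= => /andP[bs _]; rewrite /F /m.
    by rewrite (min_idPr bs).
  rewrite integral_cst//= lebesgue_measure_itv/= lte_fin ltrDl h0.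
  by rewrite -EFinB addrAC subrr add0r muleC.
rewrite -(leeD2lE _ _ I_fin).
apply: (@le_trans _ _ (\int[mu]_(s in `[0%R, b]) F (s + h)%R + \int[mu]_(s in `[0%R, h]) F s +
   ((h / 2)%:E * \int[mu]_(s in `[0%R, b]) g s ^+ 2 + (2^-1 * (h * B b))%:E))).
  by rewrite addeAC leeD2r.
rewrite E Fb -addeA leeD2l//.
have pb0 : 0 <= phi (w b) by exact: phi0.
have G0 : 0 <= \int[mu]_(s in `[0%R, b]) g s ^+ 2.
  by apply: integral_ge0 => s _; exact: expe_ge0.
move: (phi (w b)) pb0 => p p0; move: (\int[mu]_(s in `[0%R, b]) g s ^+ 2) G0 => G G0.
have bB0 : 0 <= (2^-1 * B b)%:E by rewrite lee_fin mulr_ge0.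
have G20 : 0 <= (2^-1)%:E * G by rewrite mule_ge0// lee_fin.
rewrite (ge0_muleDr _ (adde_ge0 p0 G20) bB0) (ge0_muleDr _ p0 G20).
by rewrite addeA muleA -EFinM -EFinM mulrCA.
Qed.

(** Divide [average_le] by [h] and let [h] tend to 0: by lower semicontinuity, [F] stays above any a
    < phi(w(0)) on a short interval, and so does its average. *)
Theorem energy_upper_bound :
  phi (w 0%R) <= phi (w b) + (2^-1)%:E * \int[mu]_(s in `[0%R, b]) local_slope phi (w s) ^+ 2
    + (2^-1 * B b)%:E.
Proof.
set S := (leRHS).
have S0 : 0 <= S.
  rewrite !adde_ge0// ?lee_fin ?mulr_ge0// mule_ge0// integral_ge0// => s _.
  exact/expe_ge0/local_slope_ge0.
have [->|Sf] := eqVneq S +oo; first exact: leey.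
have {}Sf : S \is a fin_num by rewrite ge0_fin_numE// ltey.
rewrite -(fineK Sf); apply: le_real_approx => a aw.
have [an|a0] := leP a 0%R; first by rewrite (le_trans an)// fine_ge0.
have [V V0 Va] := phi_lsc aw.
have F0w : w (m 0%R) = w 0%R by rewrite /m (min_idPl b0).
have : \forall s \near (0%R : R), V (w (m s)).
  have : (w \o m) @ (0%R : R) --> w 0%R.
    by rewrite -F0w; apply: continuous_comp; [exact: m_cont|exact: w_cont].
  by apply.
move=> /nbhs_ballP[e /= e0 He].
have h0 : (0 < e / 2)%R by rewrite divr_gt0.
have := average_le h0.
have -> : phi (w b) + (2^-1)%:E * \int[mu]_(s in `[0%R, b]) g s ^+ 2 + (2^-1 * B b)%:E = S by [].
have : (a * (e / 2))%:E <= \int[mu]_(s in `[0%R, (e / 2)%R]) F s.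
  rewrite (_ : (a * (e / 2))%:E = \int[mu]_(s in `[0%R, (e / 2)%R]) (cst a%:E s)); last first.
    rewrite integral_cst//= lebesgue_measure_itv/= lte_fin h0.
    by rewrite -EFinB subr0 EFinM.
  apply: ge0_le_integral => //.
  - by move=> s _; rewrite lee_fin ltW.
  - exact: measurable_funS mF.
  - move=> s; rewrite /= in_itv/= => /andP[s0 se]; apply/ltW/Va/He.
    rewrite /ball/= sub0r normrN ger0_norm//; apply: le_lt_trans se _.
    by rewrite ltr_pdivrMr// ltr_pMr// ltr1n.
move=> /le_trans /[apply]; rewrite -{1}(fineK Sf) -EFinM lee_fin mulrC.
by rewrite ler_pM2l.
Qed.

End energy.

(** The level sets of [J] are intervals, and every preimage is a countable union of them. *)
Lemma measurable_fun_nondecreasing_nat (R : realType) d (Y : measurableType d)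
    (J : R -> nat) (h : nat -> Y) : {homo J : r s / r <= s >-> (r <= s)%N} ->
  measurable_fun [set: R] (h \o J).
Proof.
move=> ndJ _ B mB; rewrite setTI.
rewrite (_ : _ @^-1` B = \bigcup_(l in [set l | B (h l)]) (J @^-1` [set l])); last first.
  apply/seteqP; split => r /=; first by move=> Br; exists (J r).
  by move=> [l /= Bl ->].
apply: bigcup_measurable => l _; apply: is_interval_measurable => r s /= rl sl z /andP[rz zs].
apply/eqP; rewrite eqn_leq; apply/andP; split.
  by rewrite -sl ndJ.
by rewrite -rl ndJ.
Qed.

(** * Discrete energies *)

Section partition.
Context {R : realType}.
Notation mu := (@lebesgue_measure R).
Variables (T : R) (N : nat) (t : nat -> R).
Hypotheses (T0 : 0 < T) (tP : is_partition T N t).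

Let t0 : t 0%N = 0. Proof. by case: tP. Qed.
Let tN : t N = T. Proof. by case: tP. Qed.
Let t_lt i : (i < N)%N -> t i < t i.+1. Proof. by case: tP => _ _; exact. Qed.

Lemma partition_le i j : (i <= j)%N -> (j <= N)%N -> t i <= t j.
Proof.
elim: j => [|j IH]; first by rewrite leqn0 => /eqP ->.
rewrite leq_eqVlt => /predU1P[->//|ij] jN.
by rewrite (le_trans (IH ij (ltnW jN)))// ltW// t_lt.
Qed.

Lemma partition_step_gt0 i : (0 < i)%N -> (i <= N)%N -> 0 < step t i.
Proof. by case: i => // i _ iN; rewrite /step/= subr_gt0 t_lt. Qed.

Lemma step_le_fineness i : (0 < i)%N -> (i <= N)%N -> step t i <= fineness N t.
Proof.
by move=> i0 iN; apply: le_bigmax_seq => //; rewrite mem_index_iota i0.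
Qed.

Lemma fineness_ge0 : 0 <= fineness N t.
Proof.
have [->|N0] := posnP N; first by rewrite /fineness big_geq.
by apply: le_trans (step_le_fineness (ltn0Sn 0) N0); rewrite ltW ?partition_step_gt0.
Qed.

Definition clamp (s : R) := Num.max 0 (Num.min s T).

Lemma clamp_in s : 0 <= clamp s <= T.
Proof. by rewrite /clamp le_max lexx/= ge_max ltW//= ge_min lexx orbT. Qed.

Lemma clamp_id s : 0 <= s <= T -> clamp s = s.
Proof. by move=> /andP[s0 sT]; rewrite /clamp (min_idPl sT) (max_idPr s0). Qed.

Lemma clamp_nd : {homo clamp : r s / r <= s}.
Proof.
move=> r s rs; rewrite /clamp ge_max le_max lexx/= le_max; apply/orP; right.
by rewrite le_min !ge_min rs lexx orbT.
Qed.

Lemma clamp_lip r s : r <= s -> clamp s - clamp r <= s - r.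
Proof.
rewrite /clamp /Num.max /Num.min => rs.
by case: (ltP r T) => ?; case: (ltP s T) => ?; case: ltP => ?; case: ltP => ?; move: T0; lra.
Qed.

(* The j with clamp s in ]t j.-1, t j], or 0 if s <= 0. Clamping extends the
   interpolant by constants to all of R. *)
Definition tindex (s : R) : nat := find (fun i => clamp s <= t i) (iota 0 N.+1).

Lemma tindex_has s : has (fun i => clamp s <= t i) (iota 0 N.+1).
Proof.
apply/hasP; exists N; first by rewrite mem_iota/= add0n.
by rewrite tN; have /andP[] := clamp_in s.
Qed.

Lemma tindex_le s : (tindex s <= N)%N.
Proof. by have := tindex_has s; rewrite has_find size_iota ltnS. Qed.

Lemma clamp_le_tindex s : clamp s <= t (tindex s).
Proof.
by have := nth_find 0%N (tindex_has s); rewrite nth_iota ?ltnS ?tindex_le.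
Qed.

Lemma lt_tindex s i : (i < tindex s)%N -> t i < clamp s.
Proof.
move=> iJ; have := before_find 0%N iJ.
by rewrite nth_iota ?ltnS ?(leq_trans (ltnW iJ) (tindex_le s))// => /negbT; rewrite -ltNge.
Qed.

Lemma tindex_nd : {homo tindex : r s / r <= s >-> (r <= s)%N}.
Proof.
move=> r s rs; rewrite leqNgt; apply/negP => /lt_tindex.
by rewrite ltNge (le_trans (clamp_nd rs) (clamp_le_tindex s)).
Qed.

Lemma tindex_le0 s : s <= 0 -> tindex s = 0%N.
Proof.
move=> s0; apply/eqP; rewrite -leqn0 leqNgt; apply/negP => /lt_tindex.
by rewrite t0 /clamp (_ : Num.max _ _ = 0) ?ltxx//; apply/max_idPl; rewrite ge_min s0.
Qed.

Lemma tindex_fineness s : t (tindex s) <= clamp s + fineness N t.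
Proof.
have /andP[c0 _] := clamp_in s.
have [->|J0] := posnP (tindex s); first by rewrite t0 addr_ge0// fineness_ge0.
have := step_le_fineness J0 (tindex_le s); rewrite /step => H.
have : t (tindex s).-1 < clamp s by apply: lt_tindex; rewrite prednK.
lra.
Qed.

Lemma tindex_interval j s : (j < N)%N -> t j < s <= t j.+1 -> tindex s = j.+1.
Proof.
move=> jN /andP[js sj].
have cs : clamp s = s.
  have tj0 : t 0%N <= t j by apply: partition_le => //; exact: ltnW.
  have tjN : t j.+1 <= t N by exact: partition_le.
  apply: clamp_id; rewrite -[X in X <= _ <= _]t0 -[X in _ <= _ <= X]tN.
  by rewrite (le_trans tj0 (ltW js)) (le_trans sj tjN).
apply/eqP; rewrite eqn_leq; apply/andP; split.
  by rewrite leqNgt; apply/negP => /lt_tindex; rewrite cs ltNge sj.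
rewrite ltnNge; apply/negP => Jj.
have := clamp_le_tindex s; rewrite cs leNgt => /negP; apply.
by apply: le_lt_trans js; apply: partition_le => //; exact: ltnW.
Qed.

Lemma backward_interpolantE (X : Type) (x : nat -> X) (ubar : R -> X) s :
  backward_interpolant N t x ubar -> 0 <= s <= T -> ubar s = x (tindex s).
Proof.
move=> [u0 uj] s0T; have /andP[s0 sT] := s0T.
have [->|sn0] := eqVneq s 0; first by rewrite u0 tindex_le0.
have sp : 0 < s by rewrite lt_neqAle eq_sym sn0.
have J0 : (0 < tindex s)%N.
  rewrite lt0n; apply/negP => /eqP J0.
  by have := clamp_le_tindex s; rewrite J0 t0 clamp_id// leNgt sp.
apply: uj; first by rewrite J0 tindex_le.
have := clamp_le_tindex s.
have : t (tindex s).-1 < clamp s by apply: lt_tindex; rewrite prednK.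
by rewrite clamp_id// in_itv/= => -> ->.
Qed.

(** Equality holds at nodes; for general [s] the domain is enlarged up to the node
    [t (tindex s)]. *)
Lemma integral_tindex_le (h : nat -> \bar R) (s : R) : (forall i, (0 <= h i)%E) ->
  0 <= s <= T ->
  (\int[mu]_(r in `[0%R, s]) h (tindex r) <=
    \sum_(1 <= l < (tindex s).+1) (step t l)%:E * h l)%E.
Proof.
move=> h0 s0T.
have mh (D : set R) : measurable_fun D (fun r => h (tindex r)).
  apply: measurable_funS measurableT _ _ => //.
  exact: (measurable_fun_nondecreasing_nat h tindex_nd).
have H j : (j <= N)%N -> (\int[mu]_(r in `[0%R, t j]) h (tindex r) =
    \sum_(1 <= l < j.+1) (step t l)%:E * h l)%E.
  elim: j => [_|j IH jN].
    by rewrite t0 big_geq// set_itv1 integral_set1.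
  have tj0 : 0 <= t j by rewrite -[X in X <= _]t0; apply: partition_le => //; exact: ltnW.
  rewrite big_nat_recr//= -IH; last exact: ltnW.
  have -> : `[0, t j.+1]%classic = `[0, t j]%classic `|` `]t j, t j.+1]%classic :> set R.
    by rewrite -itv_bndbnd_setU// bnd_simp// ltW// t_lt.
  rewrite ge0_integral_setU//; last first.
  - apply/disj_setPS => r [/=]; rewrite !in_itv/= => /andP[_ rt] /andP[].
    by rewrite ltNge rt.
  - exact: mh.
  congr (_ + _)%E; rewrite (eq_integral (cst (h j.+1))); last first.
    move=> r; rewrite inE/= in_itv/= => /andP[jr rj].
    by rewrite (tindex_interval jN)// jr.
  rewrite integral_cst//= lebesgue_measure_itv/= lte_fin t_lt// muleC.
  by rewrite -EFinB.
rewrite -H; last exact: tindex_le.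
apply: ge0_subset_integral => //; first exact: mh.
move=> r /=; rewrite !in_itv/= => /andP[-> rs]/=; apply: le_trans rs _.
by have := clamp_le_tindex s; rewrite clamp_id.
Qed.

End partition.

Section discrete_energy.
Context {R : realType} {X : metricType R}.
Variables (phi : X -> \bar R) (T : R) (N : nat) (t : nat -> R) (x : nat -> X).
Hypotheses (phi0 : forall v, (0 <= phi v)%E) (T0 : 0 < T)
  (tP : is_partition T N t) (xD : forall i, (i <= N)%N -> dom_slope phi (x i)).

Let p i := fine (phi (x i)).
Let sl i := fine (local_slope phi (x i)).
Let dd i := mdist (x i) (x i.-1).
Let G i := p i + dd i ^+ 2 / (2 * step t i) + step t i / 2 * sl i ^+ 2 - p i.-1.

Let pE i : (i <= N)%N -> phi (x i) = (p i)%:E.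
Proof. by move=> /xD[pi _]; rewrite /p fineK// ge0_fin_numE. Qed.

Let slE i : (i <= N)%N -> local_slope phi (x i) = (sl i)%:E.
Proof. by move=> /xD[_ pi]; rewrite /sl fineK// ge0_fin_numE// local_slope_ge0. Qed.

Let GE i : (0 < i)%N -> (i <= N)%N -> Ghat phi (step t i) (x i) (x i.-1) = (G i)%:E.
Proof.
move=> i0 iN; rewrite /Ghat pE// slE// (pE (leq_trans (leq_pred i) iN)).
by rewrite -EFin_expe -EFinM -!EFinD.
Qed.

Let tau_gt0 i : (0 < i)%N -> (i <= N)%N -> 0 < step t i.
Proof. by move=> i0 iN; apply: partition_step_gt0 tP _ i0 iN. Qed.

Definition defect : R :=
  fine (\sum_(1 <= i < N.+1)
    maxe (Ghat phi (step t i) (x i) (x i.-1)) 0)%E.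

Let defectE : defect = \sum_(1 <= i < N.+1) Num.max (G i) 0.
Proof.
rewrite /defect (eq_big_nat _ _ (F2 := fun i => (Num.max (G i) 0)%:E)); last first.
  by move=> i /andP[i0 iN]; rewrite GE// EFin_max.
by rewrite sumEFin.
Qed.

Lemma defect_EFin : (\sum_(1 <= i < N.+1)
    maxe (Ghat phi (step t i) (x i) (x i.-1)) 0)%E = defect%:E.
Proof.
rewrite defectE -sumEFin; apply: eq_big_nat => i /andP[i0 iN].
by rewrite GE// EFin_max.
Qed.

Definition speed_energy (j : nat) : R := \sum_(1 <= l < j.+1) mdist (x l) (x l.-1) ^+ 2 / step t l.

Definition slope_energy (j : nat) : R :=
  \sum_(1 <= l < j.+1) step t l * fine (local_slope phi (x l)) ^+ 2.

Lemma speed_energyS j : speed_energy j.+1 = speed_energy j + mdist (x j.+1) (x j) ^+ 2 / step t j.+1.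
Proof. by rewrite /speed_energy big_nat_recr. Qed.

Lemma slope_energyS j : slope_energy j.+1 = slope_energy j + step t j.+1 * fine (local_slope phi (x j.+1)) ^+ 2.
Proof. by rewrite /slope_energy big_nat_recr. Qed.

Lemma speed_energy0 : speed_energy 0 = 0.
Proof. by rewrite /speed_energy big_geq. Qed.

Lemma slope_energy0 : slope_energy 0 = 0.
Proof. by rewrite /slope_energy big_geq. Qed.

Lemma speed_energy_nd i j : (i <= j)%N -> (j <= N)%N -> speed_energy i <= speed_energy j.
Proof.
elim: j => [|j IH]; first by rewrite leqn0 => /eqP ->.
rewrite leq_eqVlt => /predU1P[->//|ij] jN.
rewrite (le_trans (IH ij (ltnW jN)))// speed_energyS lerDl divr_ge0 ?sqr_ge0//.
by rewrite ltW// tau_gt0.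
Qed.

Lemma slope_energy_ge0 j : (j <= N)%N -> 0 <= slope_energy j.
Proof.
elim: j => [_|j IH jN]; first by rewrite slope_energy0.
by rewrite slope_energyS addr_ge0 ?(IH (ltnW jN))// mulr_ge0 ?sqr_ge0// ltW// tau_gt0.
Qed.

Lemma speed_energy_ge0 j : (j <= N)%N -> 0 <= speed_energy j.
Proof. by move=> jN; rewrite -speed_energy0; exact: speed_energy_nd. Qed.

(** Each value of [Ghat] is exactly the increment of the left-hand side over one step. Replacing it
    by its positive part lets any partial sum be bounded by the full defect. *)
Lemma discrete_energy j : (j <= N)%N ->
  fine (phi (x j)) + 2^-1 * speed_energy j + 2^-1 * slope_energy j <=
  fine (phi (x 0%N)) + defect.
Proof.
move=> jN.
have le_part : forall i, (i <= N)%N -> p i + 2^-1 * speed_energy i + 2^-1 * slope_energy i <=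
    p 0%N + \sum_(1 <= l < i.+1) Num.max (G l) 0.
  elim=> [_|i IH iN].
    by rewrite speed_energy0 slope_energy0 big_geq// !mulr0 !addr0.
  rewrite speed_energyS slope_energyS big_nat_recr//=.
  have := IH (ltnW iN).
  have : G i.+1 <= Num.max (G i.+1) 0 by rewrite le_max lexx.
  have -> : G i.+1 = p i.+1 + 2^-1 * (mdist (x i.+1) (x i) ^+ 2 / step t i.+1)
      + 2^-1 * (step t i.+1 * sl i.+1 ^+ 2) - p i.
    by rewrite /G /dd/=; field; rewrite gt_eqF// tau_gt0.
  rewrite /sl; lra.
apply: le_trans (le_part j jN) _; rewrite lerD2l defectE.
rewrite [leRHS](@big_cat_nat _ _ _ j.+1)//= lerDl sumr_ge0// => l _.
by rewrite le_max lexx orbT.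
Qed.

(** Cauchy-Schwarz for the sum of the step lengths, by induction so that no square roots appear. *)
Lemma discrete_distance i j : (i <= j)%N -> (j <= N)%N ->
  mdist (x i) (x j) ^+ 2 <= (t j - t i) * (speed_energy j - speed_energy i).
Proof.
elim: j => [|j IH].
  by rewrite leqn0 => /eqP -> _; rewrite mdistxx subrr mul0r expr0n.
rewrite leq_eqVlt => /predU1P[->|ij] jN.
  by rewrite mdistxx subrr mul0r expr0n.
have {IH} IHj := IH ij (ltnW jN).
have tri := metric_triangle (x i) (x j) (x j.+1).
have P0 : 0 <= t j - t i by rewrite subr_ge0 (partition_le tP)// ltnW.
have S0 : 0 <= speed_energy j - speed_energy i by rewrite subr_ge0 speed_energy_nd// ltnW.
have Q0 := tau_gt0 (ltn0Sn j) jN.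
rewrite speed_energyS [mdist (x j.+1) _]metric_sym.
have -> : t j.+1 - t i = (t j - t i) + step t j.+1 by rewrite /step/=; ring.
rewrite [X in _ <= _ * X]addrAC.
move: P0 S0 Q0 IHj tri; move: (t j - t i) (speed_energy j - speed_energy i) (step t j.+1).
have := mdist_ge0 (x i) (x j); have := mdist_ge0 (x j) (x j.+1).
have := mdist_ge0 (x i) (x j.+1).
move: (mdist (x i) (x j)) (mdist (x j) (x j.+1)) (mdist (x i) (x j.+1)) => a b c c0 b0 a0 P S Q P0 S0 Q0 aPS cab.
have : c ^+ 2 <= (a + b) ^+ 2 by rewrite ler_sqr ?nnegrE ?addr_ge0.
move=> /le_trans; apply.
have -> : (P + Q) * (S + b ^+ 2 / Q) = P * S + b ^+ 2 + (P * b ^+ 2 + Q ^+ 2 * S) / Q.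
  by field; rewrite gt_eqF.
(* This bounds the cross term 2 a b. Multiplied by P, it follows from (P b - Q a)^2 >= 0 and a^2 <=
   P S; if P = 0, then a = 0. *)
suff : 2 * a * b * Q <= P * b ^+ 2 + Q ^+ 2 * S.
  by rewrite -ler_pdivlMr//; nra.
have [P00|Pn] := eqVneq P 0.
  have a00 : a = 0.
    by apply/eqP; rewrite -sqrf_eq0 eq_le sqr_ge0 andbT (le_trans aPS)// P00 mul0r.
  by rewrite a00 P00 mulr0 !mul0r add0r mulr_ge0// sqr_ge0.
have Pp : 0 < P by rewrite lt_neqAle eq_sym Pn.
rewrite -subr_ge0 -(pmulr_rge0 _ Pp).
have : 0 <= (P * b - Q * a) ^+ 2 by rewrite sqr_ge0.
have : Q ^+ 2 * a ^+ 2 <= Q ^+ 2 * (P * S) by rewrite ler_wpM2l// sqr_ge0.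
lra.
Qed.

End discrete_energy.

(** A set of [U] meets every tail, because [U] contains the tails. This converts limits along [U]
    into limits of an honest subsequence. *)
Lemma ultra_subsequence (U : set_system nat) (P : nat -> set nat) :
  UltraFilter U -> \oo `<=` U -> (forall m, U (P m)) ->
  exists k : nat -> nat, {homo k : m n / (m < n)%N} /\ forall m, P m (k m).
Proof.
move=> UU ooU UP.
have pick m N : exists n, P m n /\ (N < n)%N.
  have : U (P m `&` [set n | (N < n)%N]).
    by apply: filterI => //; apply: ooU; exists N.+1.
  by move=> /filter_ex[n [Pn Nn]]; exists n.
pose next m N := sval (cid (pick m N)).
have nextP m N : P m (next m N) /\ (N < next m N)%N by exact: svalP (cid (pick m N)).
pose k := fix k m := if m is m'.+1 then next m (k m') else next 0%N 0%N.
exists k; split=> [|[|m]]; last 2 first.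
- exact: (nextP _ _).1.
- exact: (nextP _ _).1.
- apply: homo_ltn; first exact: ltn_trans.
  by move=> m; exact: (nextP _ _).2.
Qed.

Lemma le_real_approx_ereal (R : realType) (x y : \bar R) :
  (forall a : R, (a%:E < x)%E -> (a%:E <= y)%E) -> (x <= y)%E.
Proof.
case: y => [y| |] H; first by apply: le_real_approx => a /H; rewrite lee_fin.
  exact: leey.
case: x H => [x| |] H //.
  by have := H (x - 1); rewrite lte_fin gtrBl ltr01 => /(_ isT).
by have := H 0 (ltry _).
Qed.

Lemma lower_semicontinuous_limn_einf (R : realType) (X : topologicalType)
    (psi : X -> \bar R) (x : nat -> X) (p : X) : lower_semicontinuous psi ->
  x @ \oo --> p -> (psi p <= limn_einf (psi \o x))%E.
Proof.
move=> lpsi xp; apply: le_real_approx_ereal => a /lpsi[V Vp Va].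
rewrite limn_einf_lim; apply: lime_ge; first exact: is_cvg_einfs.
have [n0 _ Hn] := xp _ Vp.
exists n0 => // n /= n0n; apply: le_ereal_inf_tmp => _ [k /= nk <-].
by apply/ltW/Va/Hn => /=; exact: leq_trans nk.
Qed.

Lemma lower_semicontinuous_sqr (R : realType) (X : topologicalType)
    (psi : X -> \bar R) : (forall x, (0 <= psi x)%E) ->
  lower_semicontinuous psi -> lower_semicontinuous (fun x => psi x ^+ 2)%E.
Proof.
move=> psi0 lpsi x a ax; have [a0|a0] := ltP a 0.
  exists setT; first exact: filterT.
  by move=> y _; rewrite (lt_le_trans (y := 0%E)) ?lte_fin// expe_ge0.
have sqE y : (((Num.sqrt a)%:E < psi y) = (a%:E < psi y ^+ 2))%E.
  have := psi0 y; case: (psi y) => [r| |//] r0.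
    by rewrite -EFin_expe !lte_fin -{2}(sqr_sqrtr a0) ltr_sqr ?nnegrE ?sqrtr_ge0.
  by rewrite expe2 mulyy !ltry.
have [V Vx Va] := lpsi x (Num.sqrt a) (etrans (sqE x) ax).
by exists V => // y /Va; rewrite sqE.
Qed.

(** * Compactness and the limit curve *)

Section limit_curve.
Context {R : realType} {X : metricType R}.
Notation mu := (@lebesgue_measure R).
Variables (phi : X -> \bar R) (V : nat -> R -> X) (A G : nat -> R -> R)
  (tau eps : nat -> R) (p0 T : R).
Hypotheses (phi0 : forall v, (0 <= phi v)%E) (phi_lsc : lower_semicontinuous phi)
  (slope_lsc : lower_semicontinuous (local_slope phi))
  (phi_compact : forall c : R, compact [set v | (phi v <= c%:E)%E])
  (VA : forall n r s, r <= s ->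
    mdist (V n r) (V n s) ^+ 2 <= (s - r + tau n) * (A n s - A n r))
  (ndA : forall n, {homo A n : r s / r <= s})
  (A0 : forall n s, 0 <= A n s) (G0 : forall n s, 0 <= G n s)
  (V_fin : forall n s, (phi (V n s) < +oo)%E)
  (energy : forall n s,
    fine (phi (V n s)) + 2^-1 * A n s + 2^-1 * G n s <= p0 + eps n)
  (mV : forall n, measurable_fun [set: R] (fun r => local_slope phi (V n r)))
  (VG : forall n s, 0 <= s <= T ->
    (\int[mu]_(r in `[0%R, s]) local_slope phi (V n r) ^+ 2 <= (G n s)%:E)%E)
  (tau0 : forall n, 0 <= tau n)
  (tau_cvg : tau n @[n --> \oo] --> 0) (eps_cvg : eps n @[n --> \oo] --> 0).

Variable U : set_system nat.
Hypotheses (UU : UltraFilter U) (ooU : \oo `<=` U).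

(** Once [eps n <= 1], dropping the other nonnegative terms of [energy] leaves [A n s / 2] and
    [G n s / 2] below [p0 + 1]. *)
Let K := 2 * (p0 + 1).

Let near_eps : \forall n \near U, eps n <= 1.
Proof. by apply: ooU; move: eps_cvg => /cvgr_le; apply; exact: ltr01. Qed.

Let phiV n s : phi (V n s) = (fine (phi (V n s)))%:E.
Proof. by rewrite fineK// ge0_fin_numE. Qed.

Let phiV0 n s : 0 <= fine (phi (V n s)).
Proof. by rewrite fine_ge0. Qed.

Let bounds n s : eps n <= 1 ->
  [/\ (phi (V n s) <= (p0 + 1)%:E)%E, A n s <= K & G n s <= K].
Proof.
move=> e1; have := energy n s; have := phiV0 n s; have := A0 n s; have := G0 n s.
move=> a b c d; split; rewrite /K; [|lra|lra].
by rewrite phiV lee_fin; lra.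
Qed.

(* Along an ultrafilter the limit exists at every time, without a diagonal
   extraction. *)
Let W_ex s : exists w : X, V n s @[n --> U] --> w.
Proof.
have [|w _ Vw] := ultra_compact_cvg UU (@phi_compact (p0 + 1)) (x := V^~ s).
  by apply: filterS near_eps => n e1; have [] := bounds s e1.
by exists w.
Qed.

Let W s := sval (cid (W_ex s)).
Let W_cvg s : V n s @[n --> U] --> W s. Proof. exact: svalP (cid (W_ex s)). Qed.

Let AL s : R := lim (A n s @[n --> U]).
Let GL s : R := lim (G n s @[n --> U]).

Let A_cvg s : A n s @[n --> U] --> AL s.
Proof.
apply: (@ultra_cvg_bounded _ _ _ _ K) => //.
by apply: filterS near_eps => n e1; rewrite ger0_norm//; have [] := bounds s e1.
Qed.

Let G_cvg s : G n s @[n --> U] --> GL s.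
Proof.
apply: (@ultra_cvg_bounded _ _ _ _ K) => //.
by apply: filterS near_eps => n e1; rewrite ger0_norm//; have [] := bounds s e1.
Qed.

Let U_cvg (f : nat -> R) (l : R) : f n @[n --> \oo] --> l -> f n @[n --> U] --> l.
Proof. by move=> fl B /fl; exact: ooU. Qed.

Let ndAL : {homo AL : r s / r <= s}.
Proof.
move=> r s rs; apply: (ler_cvg_to (@A_cvg r) (@A_cvg s)).
by apply: filterE => n; exact: ndA.
Qed.

Let AL0 s : 0 <= AL s.
Proof. by apply: limr_ge; [exact: cvgP (@A_cvg s)|exact: filterE]. Qed.

Let AL_le s : AL s <= K.
Proof.
apply: limr_le; first exact: cvgP (@A_cvg s).
by apply: filterS near_eps => n e1; have [] := bounds s e1.
Qed.

Let WA r s : r <= s -> mdist (W r) (W s) ^+ 2 <= (s - r) * (AL s - AL r).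
Proof.
move=> rs.
have H1 : mdist (V n r) (V n s) ^+ 2 @[n --> U] --> mdist (W r) (W s) ^+ 2.
  by rewrite expr2; apply: cvgM; exact: cvg_mdist.
have H2 : (s - r + tau n) * (A n s - A n r) @[n --> U] --> (s - r) * (AL s - AL r).
  apply: cvgM; last exact: cvgB.
  by rewrite -[X in _ --> X]addr0; apply: cvgD; [exact: cvg_cst|exact: U_cvg].
by apply: (ler_cvg_to H1 H2); apply: filterE => n; exact: VA.
Qed.

Let W_energy s : (phi (W s) + (2^-1 * AL s)%:E + (2^-1 * GL s)%:E <= p0%:E)%E.
Proof.
rewrite -addeA -EFinD -leeBrDr// -EFinB; apply: le_real_approx => a /phi_lsc[B BW Ba].
rewrite lerBrDr.
have H1 : a + (2^-1 * A n s + 2^-1 * G n s) @[n --> U] --> a + (2^-1 * AL s + 2^-1 * GL s).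
  by apply: cvgD; [exact: cvg_cst|apply: cvgD; apply: cvgMr].
have H2 : p0 + eps n @[n --> U] --> p0.
  by rewrite -[X in _ --> X]addr0; apply: cvgD; [exact: cvg_cst|exact: U_cvg].
apply: (ler_cvg_to H1 H2).
have : \forall n \near U, B (V n s) by exact: (@W_cvg s).
apply: filterS => n /Ba; rewrite phiV lte_fin => an.
by have := energy n s; lra.
Qed.

Let ratn (n : nat) : R := ratr (odflt 0 (unpickle n)).
Let d (m : nat) : R := m.+1%:R^-1.
Let d_gt0 m : 0 < d m. Proof. by rewrite invr_gt0. Qed.

Let K0 : 0 <= K.
Proof. by apply: le_trans (AL0 0) (AL_le 0). Qed.

Let V_dist n r s e : 0 < e -> eps n <= 1 -> (`|s - r| + tau n) * K < e ^+ 2 ->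
  mdist (V n r) (V n s) < e.
Proof.
move=> e0 e1; wlog rs : r s / r <= s => [H|].
  have [rs|/ltW sr] := leP r s; first exact: H.
  by rewrite distrC metric_sym; exact: H.
rewrite ger0_norm ?subr_ge0// => H.
rewrite -ltr_sqr ?nnegrE ?mdist_ge0// ?(ltW e0)//.
apply: le_lt_trans H; apply: le_trans (VA n rs) _.
have sr0 : 0 <= s - r + tau n by rewrite addr_ge0 ?subr_ge0 ?tau0.
rewrite (ler_wpM2l sr0)// lerBlDr ler_wpDr ?A0//.
by have [] := bounds s e1.
Qed.

Let W_dist r s e : 0 < e -> `|s - r| * K < e ^+ 2 -> mdist (W r) (W s) < e.
Proof.
move=> e0; wlog rs : r s / r <= s => [H|].
  have [rs|/ltW sr] := leP r s; first exact: H.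
  by rewrite distrC metric_sym; exact: H.
rewrite ger0_norm ?subr_ge0// => H.
rewrite -ltr_sqr ?nnegrE ?mdist_ge0// ?(ltW e0)//.
apply: le_lt_trans H; apply: le_trans (WA rs) _.
by rewrite ler_wpM2l ?subr_ge0// lerBlDr ler_wpDr.
Qed.

(* Convergence at the rational times, equicontinuity up to tau n and continuity
   of W give convergence at all times. *)
Lemma limit_subsequence (q : nat -> R) (l : R) : q n @[n --> U] --> l ->
  exists k : nat -> nat, [/\ {homo k : m n / (m < n)%N},
    forall s, V (k n) s @[n --> \oo] --> W s & q (k n) @[n --> \oo] --> l].
Proof.
move=> ql.
(* Stage m asks for accuracy [d m] at the first m rationals only, a finite intersection of sets of
   [U]. *)
pose P m := [set n | [/\ eps n <= 1, tau n < d m, `|l - q n| < d m &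
  forall i : 'I_m, mdist (W (ratn i)) (V n (ratn i)) < d m]].
have UP m : U (P m).
  have h1 : \forall n \near U, tau n < d m.
    by apply: ooU; move: tau_cvg => /cvgr_lt; apply.
  have h2 : \forall n \near U, `|l - q n| < d m.
    by move/cvgrPdist_lt : ql; apply.
  have h3 : \forall n \near U, forall i : 'I_m, mdist (W (ratn i)) (V n (ratn i)) < d m.
    apply: filter_forall => i.
    by have := @W_cvg (ratn i) _ (nbhsx_ballx _ _ (d_gt0 m)); rewrite ballEmdist.
  have h12 : \forall n \near U, tau n < d m /\ `|l - q n| < d m by exact: filterI h1 h2.
  have h30 : \forall n \near U, eps n <= 1 /\ (forall i : 'I_m, mdist (W (ratn i)) (V n (ratn i)) < d m).
    exact: filterI near_eps h3.
  by apply: filterS2 h12 h30 => n [? ?] [? ?]; split.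
have [k [kincr kP]] := ultra_subsequence UU ooU UP.
exists k; split => //; last first.
  apply/cvgrPdist_lt => e e0; near=> m.
  have [_ _ H _] := kP m; apply: lt_trans H _.
  by near: m; exact: near_infty_natSinv_lt (PosNum e0).
move=> s; apply/metricType_numDomainType.cvgrPdist_lt => e e0.
have e3 : 0 < e / 3 by rewrite divr_gt0.
(* Chosen so that [(D + D) * (K + 1) = (e / 3) ^+ 2]: one [D] bounds the distance to a rational
   time, the other bounds [tau]. *)
pose D := (e / 3) ^+ 2 / (2 * (K + 1)).
have K1 : 0 < K + 1 by rewrite ltr_wpDl.
have D0 : 0 < D by rewrite divr_gt0 ?exprn_gt0// mulr_gt0.
have DK : (D + D) * K < (e / 3) ^+ 2.
  have -> : (e / 3) ^+ 2 = (D + D) * (K + 1) by rewrite /D; field; rewrite gt_eqF.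
  by rewrite ltr_pM2l ?addr_gt0// ltrDl.
have [i si] : exists i, `|s - ratn i| < D.
  have [|r] := @rat_in_itvoo R s (s + D); first by rewrite ltrDl.
  rewrite in_itv/= => /andP[sr rs]; exists (pickle r).
  by rewrite /ratn pickleK/= distrC gtr0_norm ?subr_gt0// ltrBlDl.
near=> m.
have im : (i < m)%N by near: m; exact: nbhs_infty_gt.
have dD : d m < D by near: m; exact: near_infty_natSinv_lt (PosNum D0).
have de : d m < e / 3 by near: m; exact: near_infty_natSinv_lt (PosNum e3).
have [e1 tm _ Hi] := kP m.
have h1 : mdist (W s) (W (ratn i)) < e / 3.
  apply: W_dist => //; rewrite distrC; apply: le_lt_trans DK.
  by rewrite ler_wpM2r// (le_trans (ltW si))// lerDl ltW.
have h2 : mdist (W (ratn i)) (V (k m) (ratn i)) < e / 3.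
  exact: lt_trans (Hi (Ordinal im)) de.
have h3 : mdist (V (k m) (ratn i)) (V (k m) s) < e / 3.
  apply: V_dist => //; apply: le_lt_trans DK.
  by rewrite ler_wpM2r// lerD// ltW// (lt_trans tm).
have := metric_triangle (W s) (W (ratn i)) (V (k m) s).
have := metric_triangle (W (ratn i)) (V (k m) (ratn i)) (V (k m) s).
lra.
Unshelve. all: by end_near. Qed.

Let W_cont : continuous W.
Proof.
move=> r; apply/metricType_numDomainType.cvgrPdist_lt => e e0.
have K1 : 0 < K + 1 by rewrite ltr_wpDl.
have d0 : 0 < e ^+ 2 / (K + 1) by rewrite divr_gt0 ?exprn_gt0.
apply/nbhs_ballP; exists (e ^+ 2 / (K + 1)) => //= z.
rewrite /ball/= distrC ltr_pdivlMr// => H; apply: W_dist => //; apply: le_lt_trans H.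
by rewrite ler_wpM2l// lerDl.
Qed.

(** Fatou's lemma needs a sequence, so a subsequence is extracted for each [s], with [G] at time [s]
    converging as well. It may depend on [s], because its limit is always the same [W]. *)
Let W_slope s : 0 <= s <= T ->
  (\int[mu]_(r in `[0%R, s]) local_slope phi (W r) ^+ 2 <= (GL s)%:E)%E.
Proof.
move=> sT; have [k [_ kW kG]] := limit_subsequence (@G_cvg s).
have mV2 n (D : set R) : measurable_fun D (fun r => local_slope phi (V n r) ^+ 2)%E.
  under eq_fun do rewrite expe2.
  by apply: emeasurable_funM; exact: measurable_funS (mV n).
have lsc2 := lower_semicontinuous_sqr (@local_slope_ge0 _ _ phi) slope_lsc.
apply: (@le_trans _ _ (\int[mu]_(r in `[0%R, s])
    limn_einf (fun m => local_slope phi (V (k m) r) ^+ 2))%E).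
  apply: ge0_le_integral => //.
  - by move=> r _; rewrite expe_ge0// local_slope_ge0.
  - apply: measurable_funS measurableT _ _ => //.
    apply: lower_semicontinuous_measurable.
    exact: (lower_semicontinuous_comp lsc2 W_cont).
  - by apply: measurable_fun_limn_einf => m; exact: mV2.
  - by move=> r _; exact: (lower_semicontinuous_limn_einf lsc2 (kW r)).
apply: (@le_trans _ _ (limn_einf (fun m => \int[mu]_(r in `[0%R, s])
    local_slope phi (V (k m) r) ^+ 2))%E).
  apply: fatou => // [m|m r _]; first exact: mV2.
  by rewrite expe_ge0// local_slope_ge0.
apply: (@le_trans _ _ (limn_einf (fun m => (G (k m) s)%:E))).
  by apply: le_limn_einf => m; exact: VG.
have /cvg_limn_einf_sup[-> _]// : ((G (k m) s)%:E @[m --> \oo] --> (GL s)%:E)%E.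
by apply: cvg_EFin; [exact: nearW|exact: kG].
Qed.

Theorem limit_curve_exists : exists (k : nat -> nat) (w : R -> X) (B : R -> R) (M : R),
  [/\ {homo k : m n / (m < n)%N}, continuous w,
      forall s, V (k n) s @[n --> \oo] --> w s,
      [/\ {homo B : r s / r <= s}, forall s, 0 <= B s, forall s, B s <= M &
          forall r s, r <= s -> mdist (w r) (w s) ^+ 2 <= (s - r) * (B s - B r)] &
      forall s, 0 <= s <= T ->
        (phi (w s) + (2^-1 * B s)%:E +
         (2^-1)%:E * \int[mu]_(r in `[0%R, s]) local_slope phi (w r) ^+ 2 <= p0%:E)%E].
Proof.
(* [A_cvg 0] merely supplies some scalar sequence; what is kept is the convergence of the curves. *)
have [k [kincr kW _]] := limit_subsequence (@A_cvg 0).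
exists k, W, AL, K; split => // s sT.
apply: le_trans (W_energy s); rewrite leeD2l// EFinM lee_wpmul2l//.
exact: W_slope.
Qed.

End limit_curve.

(** * Curves of maximal slope *)

Section metric_derivative_energy.
Context {R : realType} {X : metricType R}.
Notation mu := (@lebesgue_measure R).
Variables (w : R -> X) (N : R -> R) (T M : R).
Hypotheses (T0 : 0 <= T) (mN : measurable_fun [set: R] N) (N0 : forall t, 0 <= N t)
  (N2 : (\int[mu]_(t in `[0%R, T]) (N t ^+ 2)%:E <= M%:E)%E)
  (wN : forall s t, 0 <= s -> s <= t -> t <= T ->
    ((mdist (w s) (w t))%:E <= \int[mu]_(x in `[s, t]) (N x)%:E)%E).

(** Frozen after [T], so as to be monotone on all of R like the function [B] that it replaces in the
    energy bound. *)
Definition kinetic (b : R) : R :=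
  fine (\int[mu]_(t in `[0%R, Num.min b T]) (N t ^+ 2)%:E).

Let mN2 (D : set R) : measurable_fun D (fun t => (N t ^+ 2)%:E).
Proof. by apply/measurable_EFinP/measurable_funX; exact: measurable_funS mN. Qed.

Let sub_T (D : set R) : measurable D -> D `<=` `[0, T] ->
  (\int[mu]_(t in D) (N t ^+ 2)%:E)%E \is a fin_num.
Proof.
move=> mD DT; rewrite ge0_fin_numE; last first.
  by apply: integral_ge0 => t _; rewrite lee_fin sqr_ge0.
apply: le_lt_trans (ltry M); apply: le_trans N2; apply: ge0_subset_integral => //.
  exact: mN2.
by move=> t _; rewrite lee_fin sqr_ge0.
Qed.

Let minT_sub b : `[0, Num.min b T]%classic `<=` `[0, T]%classic.
Proof.
by move=> t /=; rewrite !in_itv/= le_min => /andP[-> /andP[_ ->]].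
Qed.

Lemma kineticE b : 0 <= b <= T ->
  (kinetic b)%:E = (\int[mu]_(t in `[0%R, b]) (N t ^+ 2)%:E)%E.
Proof.
move=> /andP[b0 bT]; rewrite /kinetic (min_idPl bT) fineK//; apply: sub_T => //.
by rewrite -{1}(min_idPl bT); exact: minT_sub.
Qed.

Lemma kinetic_ge0 b : 0 <= kinetic b.
Proof. by apply/fine_ge0/integral_ge0 => t _; rewrite lee_fin sqr_ge0. Qed.

Lemma kinetic_nd : {homo kinetic : x y / x <= y}.
Proof.
move=> x y xy; apply: fine_le; [exact: sub_T|exact: sub_T|].
apply: ge0_subset_integral => //; first exact: mN2.
  by move=> t _; rewrite lee_fin sqr_ge0.
move=> t /=; rewrite !in_itv/= !le_min => /andP[-> /andP[tx ->]].
by rewrite (le_trans tx xy).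
Qed.

(* Cauchy-Schwarz, through [2 D <= c (t - s) + Q / c] for every c > 0. *)
Lemma kinetic_dist s t : 0 <= s -> s <= t -> t <= T ->
  mdist (w s) (w t) ^+ 2 <= (t - s) * (kinetic t - kinetic s).
Proof.
move=> s0 st tT; have t0 := le_trans s0 st; have sT := le_trans st tT.
have Q : (\int[mu]_(x in `]s, t]) (N x ^+ 2)%:E = (kinetic t - kinetic s)%:E)%E.
  rewrite EFinB !kineticE ?s0 ?t0//.
  have -> : `[0, t]%classic = `[0, s]%classic `|` `]s, t]%classic :> set R.
    by rewrite -itv_bndbnd_setU// bnd_simp.
  rewrite ge0_integral_setU//; last 3 first.
  - exact: mN2.
  - by move=> x _; rewrite lee_fin sqr_ge0.
  - apply/disj_setPS => x [/=]; rewrite !in_itv/= => /andP[_ xs] /andP[].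
    by rewrite ltNge xs.
  rewrite addeAC subee ?add0e//; apply: sub_T => // x /=; rewrite !in_itv/= => /andP[-> xs]/=.
  exact: le_trans xs sT.
have mND (D : set R) : measurable_fun D (fun x => (N x)%:E).
  by apply/measurable_EFinP; exact: measurable_funS mN.
have key c : 0 < c -> 2 * mdist (w s) (w t) <= c * (t - s) + c^-1 * (kinetic t - kinetic s).
  move=> c0; rewrite -ler_pdivlMl// -lee_fin; apply: le_trans (wN s0 st tT) _.
  rewrite -(integral_itv_obnd_cbnd (mND _)) EFinM EFinD [((c^-1 * _)%:E)]EFinM -Q.
  apply: (@le_trans _ _ (\int[mu]_(x in `]s, t])
      ((2^-1)%:E * (c%:E + (c^-1)%:E * (N x ^+ 2)%:E)))%E).
    apply: ge0_le_integral => //.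
    - by move=> x _; rewrite lee_fin.
    - exact: mND.
    - apply: measurable_funeM; apply: emeasurable_funD => //.
      by apply: measurable_funeM; exact: mN2.
    - move=> x _; rewrite -EFinM lee_fin.
      have := sqr_ge0 (c - N x); rewrite -(pmulr_rge0 _ (_ : 0 < c^-1)) ?invr_gt0//.
      have -> : c^-1 * (c - N x) ^+ 2 = c - 2 * N x + c^-1 * N x ^+ 2.
        by field; rewrite gt_eqF.
      lra.
  rewrite ge0_integralZl//; last 2 first.
  - apply: emeasurable_funD => //.
    by apply: measurable_funeM; exact: mN2.
  - move=> x _; rewrite -EFinM lee_fin addr_ge0 ?(ltW c0)// mulr_ge0 ?sqr_ge0//.
    by rewrite invr_ge0 ltW.
  rewrite lee_wpmul2l// ge0_integralD//; last 3 first.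
  - by move=> x _; rewrite lee_fin ltW.
  - by move=> x _; rewrite -EFinM lee_fin mulr_ge0 ?sqr_ge0// invr_ge0 ltW.
  - by apply: measurable_funeM; exact: mN2.
  rewrite integral_cst//= lebesgue_measure_itv/= lte_fin.
  rewrite ge0_integralZl//; last 3 first.
  - exact: mN2.
  - by move=> x _; rewrite lee_fin sqr_ge0.
  - by rewrite lee_fin invr_ge0 ltW.
  rewrite leeD2r// EFinM; case: ifPn => [_|]; first by rewrite -EFinB.
  by move=> _; rewrite mule0 -EFinM lee_fin mulr_ge0 ?subr_ge0// ltW.
have d0 := mdist_ge0 (w s) (w t).
have [->|dn] := eqVneq (mdist (w s) (w t)) 0.
  by rewrite expr0n mulr_ge0// subr_ge0// kinetic_nd.
have dp : 0 < mdist (w s) (w t) by rewrite lt_neqAle eq_sym dn.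
have tsp : 0 < t - s.
  rewrite subr_gt0 lt_neqAle st andbT; apply: contra_neq dn => ->.
  exact: mdistxx.
(* This c turns the term c (t - s) into the distance itself, half of the left-hand side. *)
have := key _ (divr_gt0 dp tsp).
rewrite divfK ?gt_eqF// invf_div.
move: (mdist (w s) (w t)) dp => D dp H.
have {}H : D <= (t - s) / D * (kinetic t - kinetic s) by lra.
have := ler_wpM2l (ltW dp) H.
by rewrite mulrA mulrCA divff ?gt_eqF// mulr1 -expr2.
Qed.

End metric_derivative_energy.

Section maximal_slope.
Context {R : realType} {X : metricType R}.
Notation mu := (@lebesgue_measure R).
Variables (phi : X -> \bar R) (T : R) (w : R -> X) (B : R -> R) (M p0 : R).
Hypotheses (phi0 : forall v, (0 <= phi v)%E) (phi_lsc : lower_semicontinuous phi)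
  (slope_lsc : lower_semicontinuous (local_slope phi))
  (phi_cvx : geodesically_convex0 phi) (T0 : 0 < T)
  (w_cont : continuous w) (ndB : {homo B : r s / r <= s})
  (B0 : forall s, 0 <= B s) (BM : forall s, B s <= M)
  (wB : forall r s, r <= s -> mdist (w r) (w s) ^+ 2 <= (s - r) * (B s - B r))
  (p0E : phi (w 0) = p0%:E)
  (wE : forall s, 0 <= s <= T ->
    (phi (w s) + (2^-1 * B s)%:E +
     (2^-1)%:E * \int[mu]_(r in `[0%R, s]) local_slope phi (w r) ^+ 2 <= p0%:E)%E).

Let slope_integral (s : R) := (\int[mu]_(r in `[0%R, s]) local_slope phi (w r) ^+ 2)%E.

Let slope_integral_ge0 s : (0 <= slope_integral s)%E.
Proof. by apply: integral_ge0 => r _; rewrite expe_ge0// local_slope_ge0. Qed.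

Let phi_le s : 0 <= s <= T -> (phi (w s) <= p0%:E)%E.
Proof.
move=> sT; apply: le_trans (wE sT); rewrite -addeA leeDl// adde_ge0//.
  by rewrite lee_fin mulr_ge0.
by rewrite mule_ge0// slope_integral_ge0.
Qed.

Theorem energy_curve_of_maximal_slope :
  AC_curve 2 T w /\ curve_of_maximal_slope T phi (w 0) w.
Proof.
have [S [mS S0 SB wS md]] := metric_speed B0 BM ndB wB (ltW T0).
have S2 := SB T (ltW T0) (lexx T).
pose kin := kinetic S T.
have kinE := @kineticE _ S T (B T) mS S2.
have kin_nd := @kinetic_nd _ S T (B T) mS S2 : {homo kin : x y / x <= y}.
have mSD (D : set R) : measurable_fun D S by exact: measurable_funS mS.
(* The same speed [S] is used for p = 2 and for p = 1, both being dominated by 1 + [S]^2 on a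
   bounded interval. *)
have AC p : (forall x : R, 0 <= x -> x ^+ p <= 1 + x ^+ 2) -> AC_curve p T w.
  move=> p2; exists S; split=> [||s t s0 st tT]; first exact: mSD.
    have mSp : measurable_fun `]0, T[ (fun r => (`|S r| ^+ p)%:E).
      apply/measurable_EFinP/measurable_funX.
      by apply: measurableT_comp => //; exact: mSD.
    apply/integrableP; split=> //.
    apply: (@le_lt_trans _ _ (\int[mu]_(r in `]0%R, T[) (1%:E + (S r ^+ 2)%:E))%E).
      apply: ge0_le_integral => //.
      - exact: (measurableT_comp (@abse_measurable _ _) mSp).
      - apply: emeasurable_funD => //; apply/measurable_EFinP/measurable_funX; exact: mSD.
      - move=> r _; rewrite gee0_abs ?lee_fin ?exprn_ge0// ger0_norm//; exact: p2.
    rewrite ge0_integralD//; last 2 first.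
    - by move=> r _; rewrite lee_fin sqr_ge0.
    - by apply/measurable_EFinP/measurable_funX; exact: mSD.
    rewrite integral_cst//= lebesgue_measure_itv/= lte_fin T0 -EFinB -EFinM.
    apply: lte_add_pinfty; first exact: ltry.
    have := S2; rewrite integral_itv_bndoo; last first.
      by apply/measurable_EFinP/measurable_funX; exact: mSD.
    by move=> /le_lt_trans; apply; exact: ltry.
  apply: le_trans (wS _ _ s0 (ltW st) tT) _.
  rewrite integral_itv_bndoo//; apply/measurable_EFinP; exact: mSD.
have md_int b : 0 <= b <= T ->
    (\int[mu]_(s in `[0%R, b]) (metric_derivative w s ^+ 2)%:E = (kin b)%:E)%E.
  move=> bT; rewrite kinE//; apply: ge0_ae_eq_integral_nonmeasurable => //.
  - apply/measurable_EFinP/measurable_funX; exact: mSD.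
  - by move=> s _; rewrite lee_fin sqr_ge0.
  - by move=> s _; rewrite lee_fin sqr_ge0.
  (* The derivative is identified inside ]0, T[ only; the end points form a null set. *)
  have ne (c : R) : {ae mu, forall t, t != c}.
    exists [set c]; split => //; first exact: lebesgue_measure_set1.
    by move=> t /= /negP; rewrite negbK => /eqP.
  have := lebesgue_aeS2 (fun t a b => conj a b) (ne 0) (ne T).
  apply: lebesgue_aeS2 md => t mdt [t0 tT] /=; rewrite in_itv/= => /andP[t0' tb].
  rewrite mdt// !lt_neqAle eq_sym t0 t0' tT (le_trans tb)//.
  by case/andP: bT.
(* For [<=], the kinetic energy lies below [B]. For [>=], the upper bound is applied with [kin] in
   place of [B]. *)
have energy b : 0 <= b <= T ->
    (phi (w b) + (2^-1)%:E * (kin b)%:E + (2^-1)%:E * slope_integral b = p0%:E)%E.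
  move=> bT; have /andP[b0 bT'] := bT; apply/eqP; rewrite eq_le; apply/andP; split.
    apply: le_trans (wE bT); rewrite leeD2r// leeD2l// EFinM lee_wpmul2l// kinE//.
    exact: SB.
  rewrite -p0E addeAC -EFinM.
  apply: (energy_upper_bound (M := p0)) => //.
  - move=> t /andP[t0 tb]; apply: phi_le; rewrite t0; exact: le_trans tb bT'.
  - exact: kinetic_ge0.
  - move=> s t s0 st tb; apply: (@kinetic_dist _ _ w S T (B T)) => //.
    exact: le_trans tb bT'.
have E t : 0 <= t <= T -> phi (w t) = (fine (phi (w t)))%:E /\
    slope_integral t = (fine (slope_integral t))%:E.
  move=> tT; split; rewrite fineK// ge0_fin_numE//.
    by rewrite (le_lt_trans (phi_le tT))// ltry.
  rewrite ltey; apply/eqP => It; have := energy _ tT.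
  rewrite It gt0_muley ?lte_fin ?invr_gt0// addey//.
  by rewrite gt_eqF// (lt_le_trans (ltNyr 0)) ?adde_ge0// -EFinM lee_fin mulr_ge0// kinetic_ge0.
split; first by apply: AC => x _; rewrite lerDr.
split => //.
- by apply: AC => x x0; have := sqr_ge0 (x - 2^-1); rewrite expr1; nra.
- move=> s t; rewrite !in_itv/= => sT tT st.
  have [ps Is] := E _ sT; have [pt It] := E _ tT.
  have : (slope_integral s <= slope_integral t)%E.
    apply: ge0_subset_integral => //.
    + have m : measurable_fun `[0, t] (fun r => local_slope phi (w r)).
        apply: measurable_funS measurableT _ _ => //.
        apply: lower_semicontinuous_measurable.
        exact: (lower_semicontinuous_comp slope_lsc w_cont).
      exact: emeasurable_funM.
    + by move=> r _; rewrite expe_ge0// local_slope_ge0.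
    + by move=> r /=; rewrite !in_itv/= => /andP[-> rs]; exact: le_trans rs st.
  have := energy _ tT; rewrite -(energy _ sT) Is It ps pt -!EFinM -!EFinD => -[].
  rewrite !lee_fin; have := kin_nd _ _ st; lra.
- by move=> t; rewrite in_itv/= => tT; rewrite md_int// p0E; exact: energy.
Qed.

End maximal_slope.

Section minimizing_movement.
Context {R : realType} {X : metricType R}.
Notation mu := (@lebesgue_measure R).
Variables (phi : X -> \bar R) (T : R) (N : nat -> nat) (t : nat -> nat -> R)
  (u0 : X) (u : nat -> nat -> X).
Hypotheses (phi0 : forall v, (0 <= phi v)%E) (phi_lsc : lower_semicontinuous phi)
  (slope_lsc : lower_semicontinuous (local_slope phi))
  (phi_compact : forall c : R, compact [set v | (phi v <= c%:E)%E])
  (T0 : 0 < T) (tP : forall n, is_partition T (N n) (t n))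
  (fine_t : fineness (N n) (t n) @[n --> \oo] --> 0)
  (uD : forall n i, (i <= N n)%N -> dom_slope phi (u n i))
  (uu0 : forall n, u n 0%N = u0)
  (defect_cvg : defect phi (N n) (t n) (u n) @[n --> \oo] --> 0).

Let J n s := tindex T (N n) (t n) s.
Let J_le n s : (J n s <= N n)%N. Proof. exact: tindex_le. Qed.
Let A n s := speed_energy (t n) (u n) (J n s).
Let G n s := slope_energy phi (t n) (u n) (J n s).

Lemma backward_interpolant_limit :
  exists (k : nat -> nat) (w : R -> X) (B : R -> R) (M : R),
  [/\ {homo k : m n / (m < n)%N}, continuous w,
      forall s, u (k n) (J (k n) s) @[n --> \oo] --> w s,
      [/\ {homo B : r s / r <= s}, forall s, 0 <= B s, forall s, B s <= M &
          forall r s, r <= s -> mdist (w r) (w s) ^+ 2 <= (s - r) * (B s - B r)] &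
      forall s, 0 <= s <= T ->
        (phi (w s) + (2^-1 * B s)%:E +
         (2^-1)%:E * \int[mu]_(r in `[0%R, s]) local_slope phi (w r) ^+ 2 <=
         (fine (phi u0))%:E)%E].
Proof.
have [U [UU ooU]] := ultraFilterLemma eventually_filter.
apply: (limit_curve_exists (V := fun n s => u n (J n s)) (A := A) (G := G)
  (tau := fun n => fineness (N n) (t n)) (eps := fun n => defect phi (N n) (t n) (u n))
  phi0 phi_lsc slope_lsc phi_compact _ _ _ _ _ _ _ _ _ fine_t defect_cvg UU ooU).
(* The node reached at [s] exceeds [clamp s] by at most the fineness, and the node reached at [r] is
   at least [clamp r]; hence the extra [tau n] in the modulus. *)
- move=> n r s rs; have Jrs : (J n r <= J n s)%N by exact: tindex_nd.
  apply: le_trans (discrete_distance (u n) (tP n) Jrs (J_le n s)) _.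
  apply: ler_wpM2r; first by rewrite subr_ge0 (speed_energy_nd (u n) (tP n)).
  have := clamp_le_tindex T0 (tP n) r; have := tindex_fineness T0 (tP n) s.
  have := clamp_lip T0 rs; rewrite -/(J n r) -/(J n s); lra.
- move=> n r s rs; apply: (speed_energy_nd (u n) (tP n)); first exact: tindex_nd.
  exact: J_le.
- by move=> n s; apply: (speed_energy_ge0 (u n) (tP n)); exact: J_le.
- by move=> n s; apply: (slope_energy_ge0 phi (u n) (tP n)); exact: J_le.
- by move=> n s; have [] := uD (J_le n s).
- by move=> n s; have := discrete_energy phi0 (tP n) (uD (n := n)) (J_le n s); rewrite uu0.
- move=> n.
  exact: (measurable_fun_nondecreasing_nat (fun i => local_slope phi (u n i))
    (tindex_nd T0 (tP n))).
- move=> n s sT.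
  pose h i := (local_slope phi (u n i) ^+ 2)%E.
  have h0 i : (0 <= h i)%E by rewrite expe_ge0// local_slope_ge0.
  apply: le_trans (integral_tindex_le T0 (tP n) h0 sT) _.
  rewrite /G /slope_energy -sumEFin le_eqVlt; apply/orP; left; apply/eqP.
  apply: eq_big_nat => l /andP[_ lJ]; rewrite EFinM /h EFin_expe fineK//.
  rewrite ge0_fin_numE ?local_slope_ge0//.
  by have [] := uD (leq_trans (lJ : (l <= J n s)%N) (J_le n s)).
- by move=> n; exact: fineness_ge0 (tP n).
Qed.

End minimizing_movement.

Theorem theorem5p2 (R : realType) (X : completeMetricType R)
    (phi : X -> \bar R) (T taustar : R)
    (phi_ge0 : forall v, (0 <= phi v)%E)
    (phi_lsc : lower_semicontinuous phi)
    (T_gt0 : 0 < T)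
    (taustar_gt0 : 0 < taustar)
    (phi_convex : forall (v : X) (tau : R), 0 < tau -> tau <= taustar ->
       geodesically_convex tau^-1
         (fun u => ((mdist u v ^+ 2 / (2 * tau))%:E + phi u)%E))
    (phi_compact : forall c : R, compact [set v | (phi v <= c%:E)%E])
    (slope_lsc : lower_semicontinuous (local_slope phi))
    (phi_chain : chain_rule_inequality T phi) :
  (forall v : X, dom_slope phi v -> local_slope phi v <> 0%E ->
     forall tau : R, 0 < tau -> tau <= taustar ->
     exists u : X, [/\ dom_slope phi u, u <> v & (Ghat phi tau u v <= 0)%E])
  /\
  (forall (N : nat -> nat) (t : nat -> nat -> R)
      (u0 : X) (u : nat -> nat -> X) (ubar : nat -> R -> X),
     (forall n, is_partition T (N n) (t n)) ->
     fineness (N n) (t n) @[n --> \oo] --> 0 ->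
     (forall n i, (i <= N n)%N -> dom_slope phi (u n i)) ->
     (forall n, u n 0%N = u0) ->
     (\sum_(1 <= i < (N n).+1)
        maxe (Ghat phi (step (t n) i) (u n i) (u n i.-1)) 0)%E
       @[n --> \oo] --> 0%E ->
     (forall n, backward_interpolant (N n) (t n) (u n) (ubar n)) ->
     exists (k : nat -> nat) (w : R -> X),
       [/\ {homo k : m n / (m < n)%N},
           (forall s, s \in `[0, T] -> ubar (k n) s @[n --> \oo] --> w s),
           AC_curve 2 T w &
           curve_of_maximal_slope T phi u0 w]).
Proof.
split=> [v vD v0 tau tau0 taut|N t u0 u ubar tP tau_cvg uD uu0 defect_cvg ubarP].
  by apply: proximal_step => //; exact: phi_convex.
have phi_cvx : geodesically_convex0 phi.
  apply: (penalized_convex_geodesically_convex0 taustar_gt0 phi_ge0) => v.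
  exact: phi_convex.
have eps_cvg : defect phi (N n) (t n) (u n) @[n --> \oo] --> 0.
  move: defect_cvg; rewrite (_ : (fun n => _) = fun n => (defect phi (N n) (t n) (u n))%:E).
    by move=> /fine_cvg.
  by apply/funext => n; apply: defect_EFin => // i; exact: uD.
have [k [w [B [M [kincr wc kw [ndB B0 BM wB] wE]]]]] :=
  backward_interpolant_limit phi_ge0 phi_lsc slope_lsc phi_compact T_gt0 tP tau_cvg uD uu0 eps_cvg.
have w0 : w 0 = u0.
  apply: (cvg_unique (@metric_hausdorff _ X) (kw 0)) => /=.
  rewrite (_ : (fun n => _) = cst u0); first exact: cvg_cst.
  by apply/funext => n; rewrite (tindex_le0 T_gt0 (tP _)).
have u0E : phi (w 0) = (fine (phi u0))%:E.
  have [u0D _] := uD 0%N 0%N (leq0n _).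
  by rewrite w0 fineK// ge0_fin_numE// -(uu0 0%N).
have [wAC wmax] := energy_curve_of_maximal_slope phi_ge0 phi_lsc slope_lsc phi_cvx
  T_gt0 wc ndB B0 BM wB u0E wE.
exists k, w; split => //; last by rewrite -w0.
move=> s; rewrite in_itv/= => sT.
rewrite (_ : (fun n => _) = fun n => u (k n) (tindex T (N (k n)) (t (k n)) s)); first exact: kw.
by apply/funext => n; exact: backward_interpolantE (ubarP (k n)) sT.
Qed.
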